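(* Let $\mathcal{E}(\phi,\partial\phi)$ be a smooth energy density for fields $\phi=(\phi^a)$ on $\mathbb{R}^d$ which is invariant under the global internal symmetry $\delta\phi^a=\theta^A\,(T_A)^a_{\ b}\phi^b$ with constant parameters $\theta^A$. Let $\phi_0$ be a smooth static finite-energy solution of the static equations of motion $$\partial_i\left(\frac{\partial\mathcal{E}}{\partial(\partial_i\phi^a)}\right)=\frac{\partial\mathcal{E}}{\partial\phi^a},$$ and let $J^i_A$ be the spatial components of the associated current evaluated on $\phi_0$. Suppose that each $J_A^i$ is integrable on $\mathbb{R}^d$ and that the boundary terms vanish, i.e. for every $A$ and every $k\in\{1,\dots,d\}$ $$\lim_{R\to\infty}\oint_{|x|=R} x^k\, \hat{x}_i\, J_A^i \, d\sigma=0 .$$ Then for every $A$ and every $i\in\{1,\dots,d\}$ $$\int_{\mathbb{R}^d} J_A^i\,d^dx=0 .$$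
   Context: $\phi^a$ are real scalar fields depending on $x\in\mathbb{R}^d$; $T_A$ are constant matrices (the generators of the symmetry group in the representation of the fields). Repeated indices are summed. Invariance of $\mathcal{E}$ means $\frac{\partial\mathcal{E}}{\partial\phi^a}(T_A)^a_{\ b}\phi^b+\frac{\partial\mathcal{E}}{\partial(\partial_i\phi^a)}(T_A)^a_{\ b}\partial_i\phi^b=0$ identically, for each $A$. The current is $J_A^i=\frac{\partial\mathcal{E}}{\partial(\partial_i\phi^a)}(T_A)^a_{\ b}\phi^b$, so that under $\delta\phi^a=\theta^A(x)(T_A)^a_{\ b}\phi^b$ the first-order change of the energy $E=\int\mathcal{E}\,d^dx$ is $\int \partial_i\theta^A J^i_A\,d^dx$. Here $\hat{x}=x/|x|$ and $d\sigma$ is the surface measure on the sphere. *)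

(* Defs.v *)
From HB Require Import structures.
From mathcomp Require Import all_boot all_order all_algebra.
From mathcomp Require Import all_classical all_reals all_analysis.
From mathcomp Require Import measurable_realfun.

Set Implicit Arguments.
Unset Strict Implicit.
Unset Printing Implicit Defensive.

Import Order.TTheory GRing.Theory Num.Theory.
Import numFieldNormedType.Exports.

Local Open Scope classical_set_scope.
Local Open Scope ring_scope.

Definition rV_display : measure_display.
Proof. exact: default_measure_display. Qed.

Section borel_rV.
Variables (R : realType) (n : nat).

Let coord (i : 'I_n) (x : 'rV[R]_n) : R := x ord0 i.

Let rV_set0 : g_sigma_preimage coord set0.
Proof. exact: sigma_algebra0. Qed.

Let rV_setC A : g_sigma_preimage coord A -> g_sigma_preimage coord (~` A).
Proof. exact: sigma_algebraC. Qed.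

Let rV_bigcup (F : _^nat) : (forall i, g_sigma_preimage coord (F i)) ->
  g_sigma_preimage coord (\bigcup_i (F i)).
Proof. exact: sigma_algebra_bigcup. Qed.

(* The sigma-algebra generated by the coordinates, i.e. the Borel one. *)
HB.instance Definition _ := @isMeasurable.Build rV_display
  'rV[R]_n (g_sigma_preimage coord) rV_set0 rV_setC rV_bigcup.

Lemma measurable_coord (i : 'I_n) :
  measurable_fun [set: 'rV[R]_n] (fun x : 'rV[R]_n => x ord0 i).
Proof.
move=> _ Y mY; rewrite setTI; apply: sub_sigma_algebra => /=.
rewrite -bigcup_seq/=; exists i => /=; first by rewrite mem_index_enum.
by exists Y => //; rewrite setTI.
Qed.

Lemma measurable_fun_rV d (T : measurableType d) (f : T -> 'rV[R]_n) :
  (forall i, measurable_fun [set: T] (fun t => f t ord0 i)) ->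
  measurable_fun [set: T] f.
Proof.
move=> mf.
suff h : g_sigma_preimage (fun i => coord i \o f) `<=` measurable.
  move=> _ A mA; apply: h; rewrite g_sigma_preimage_comp.
  by exists A.
apply: smallest_sub; first exact: sigma_algebra_measurable.
rewrite -bigcup_seq/=; apply: bigcup_sub => i _ _ [B mB <-].
exact: mf.
Qed.

End borel_rV.

Section lebesgue_rV.
Variable R : realType.

Definition cons_rV n (p : R * 'rV[R]_n) : 'rV[R]_n.+1 := row_mx p.1%:M p.2.

(* n-fold product of the Lebesgue measure of the line *)
Fixpoint lebesgue_rV n : set 'rV[R]_n -> \bar R :=
  if n is n'.+1 then
    pushforward (@lebesgue_measure R \x @lebesgue_rV n')%E (@cons_rV n')
  else dirac (0 : 'rV[R]_0).

Let uncons_rV n (x : 'rV[R]_n.+1) : R * 'rV[R]_n :=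
  (x ord0 ord0, \row_j x ord0 (lift ord0 j)).

Let cons_rV0 n (p : R * 'rV[R]_n) : cons_rV p ord0 ord0 = p.1.
Proof.
rewrite (_ : ord0 = lshift n (@ord0 0)); last exact: val_inj.
by apply: etrans; [exact: row_mxEl|rewrite mxE eqxx mulr1n].
Qed.

Let cons_rVS n (p : R * 'rV[R]_n) j : cons_rV p ord0 (lift ord0 j) = p.2 ord0 j.
Proof.
rewrite (_ : lift ord0 j = rshift 1 j); last exact: val_inj.
exact: row_mxEr.
Qed.

Let cons_rVK n : cancel (@cons_rV n) (@uncons_rV n).
Proof.
move=> [a v]; congr (_, _); first exact: cons_rV0.
by apply/rowP => j; rewrite mxE; exact: cons_rVS.
Qed.

Lemma measurable_cons_rV n : measurable_fun setT (@cons_rV n).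
Proof.
apply: measurable_fun_rV => i.
case: (unliftP ord0 i) => [j|] -> {i}.
- rewrite (funext (fun p => cons_rVS p j)).
  apply: (measurableT_comp (f := fun x : 'rV[R]_n => x ord0 j)).
    exact: measurable_coord.
  exact: measurable_snd.
- rewrite (funext (@cons_rV0 n)).
  exact: measurable_fst.
Qed.

HB.instance Definition _ n :=
  isMeasurableFun.Build _ _ _ _ (@cons_rV n) (@measurable_cons_rV n).

Let measurable_uncons_rV n : measurable_fun setT (@uncons_rV n).
Proof.
apply/measurable_fun_pairP; split; first exact: measurable_coord.
apply: measurable_fun_rV => i.
rewrite (_ : (fun _ => _) = (fun x : 'rV[R]_n.+1 => x ord0 (lift ord0 i))).
  exact: measurable_coord.
by apply/funext => x; rewrite /= mxE.
Qed.

Let lebesgue_rV_exists n :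
  exists mu : {sigma_finite_measure set 'rV[R]_n -> \bar R},
    @lebesgue_rV n = mu.
Proof.
elim: n => [|n [mu muE]]; first by exists (dirac (0 : 'rV[R]_0)).
rewrite /= {}muE.
set P := (@lebesgue_measure R \x mu)%E.
have [m mE] : exists m, m = pushforward P (@cons_rV n) by eexists.
rewrite -mE.
have m0 : m set0 = 0%E by rewrite mE; exact: (measure0 P).
have mge0 A : (0 <= m A)%E by rewrite mE; exact: (measure_ge0 P).
have madd : semi_sigma_additive m.
  by rewrite mE; apply: measure_semi_sigma_additive; exact: measurable_cons_rV.
pose m1 : {measure set 'rV[R]_n.+1 -> \bar R} :=
  HB.pack m (isMeasure.Build _ _ _ m m0 mge0 madd).
have sfin : sigma_finite setT m1.
  have [F FT mF] : sigma_finite setT P.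
    have /sigma_finiteP[F [TF ndF Foo]] := sigma_finiteT (@lebesgue_measure R).
    have /sigma_finiteP[G [TG ndG Goo]] := sigma_finiteT mu.
    exists (fun k => F k `*` G k).
      rewrite -setXTT TF TG predeqE => -[x y]; split.
        move=> [/= [i _ Fix] [k _ Gky]]; exists (maxn i k) => //; split.
        - by move: x Fix; exact/subsetPset/ndF/leq_maxl.
        - by move: y Gky; exact/subsetPset/ndG/leq_maxr.
      by move=> [k _ []/= ? ?]; split; exists k.
    move=> k; have [? ?] := Foo k; have [? ?] := Goo k.
    split; first exact: measurableX.
    by rewrite /P product_measure1E// lte_mul_pinfty// ge0_fin_numE.
  exists (fun i => @uncons_rV n @^-1` F i) => [|i].
    by rewrite -preimage_bigcup -FT preimage_setT.
  have [mFi Fioo] := mF i; split.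
    by rewrite -[X in measurable X]setTI; exact: measurable_uncons_rV.
  rewrite /m1/= mE /pushforward -comp_preimage.
  by rewrite (_ : _ \o _ = id) ?preimage_id//; apply/funext => p; exact: cons_rVK.
pose m2 : {sigma_finite_measure set 'rV[R]_n.+1 -> \bar R} :=
  HB.pack m m1 (Measure_isSigmaFinite.Build _ _ _ m1 sfin).
by exists m2.
Qed.

Section instances.
Variable n : nat.

Let lebesgue_rV0 : @lebesgue_rV n set0 = 0%E.
Proof. by have [mu ->] := lebesgue_rV_exists n; exact: measure0. Qed.

Let lebesgue_rV_ge0 A : (0 <= @lebesgue_rV n A)%E.
Proof. by have [mu ->] := lebesgue_rV_exists n; exact: measure_ge0. Qed.

Let lebesgue_rV_additive : semi_sigma_additive (@lebesgue_rV n).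
Proof.
by have [mu ->] := lebesgue_rV_exists n; exact: measure_semi_sigma_additive.
Qed.

HB.instance Definition _ := isMeasure.Build _ _ _ (@lebesgue_rV n)
  lebesgue_rV0 lebesgue_rV_ge0 lebesgue_rV_additive.

Let lebesgue_rV_sigma_finite : sigma_finite setT (@lebesgue_rV n).
Proof. by have [mu ->] := lebesgue_rV_exists n; exact: sigma_finiteT. Qed.

HB.instance Definition _ := Measure_isSigmaFinite.Build _ _ _ (@lebesgue_rV n)
  lebesgue_rV_sigma_finite.

End instances.

End lebesgue_rV.
Arguments lebesgue_rV {R} n.

Section sphere.
Variables (R : realType) (n : nat).
Implicit Types (r : R) (x : 'rV[R]_n).

(* The library norm on ['rV_n] is the sup norm. *)
Definition enorm x : R := Num.sqrt (\sum_i x ord0 i ^+ 2).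

Definition esphere r : set 'rV[R]_n := [set x | enorm x = r].

Definition eball r : set 'rV[R]_n := [set x | enorm x <= r].

Definition radial_proj r x : 'rV[R]_n := (r / enorm x) *: x.

Lemma measurable_enorm : measurable_fun setT enorm.
Proof.
apply: (measurableT_comp (f := @Num.sqrt R)).
  by apply: continuous_measurable_fun; exact: sqrt_continuous.
apply: measurable_sum => i; apply: measurable_funX.
exact: measurable_coord.
Qed.

Lemma measurable_eball r : measurable (eball r).
Proof.
rewrite (_ : eball r = enorm @^-1` `]-oo, r]).
  by rewrite -[X in measurable X]setTI; exact: measurable_enorm.
by apply/seteqP; split=> x /=; rewrite in_itv.
Qed.

Lemma measurable_esphere r : measurable (esphere r).
Proof.
rewrite (_ : esphere r = enorm @^-1` [set r]) //.
by rewrite -[X in measurable X]setTI; exact: measurable_enorm.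
Qed.

Lemma measurable_radial_proj r : measurable_fun setT (radial_proj r).
Proof.
apply: measurable_fun_rV => i.
under eq_fun do rewrite mxE.
apply: measurable_funM; last exact: measurable_coord.
apply: measurable_funM => //.
have -> : (fun x : 'rV[R]_n => (enorm x)^-1) = fun x => (enorm x) `^ (-1).
  by apply/funext => x; rewrite powR_inv1// sqrtr_ge0.
apply: (measurableT_comp (measurable_powR _)).
exact: measurable_enorm.
Qed.

(* For [r > 0] this is the surface measure of the sphere of radius [r], given
   by its cone formula: the area of [A] is [n / r] times the volume of the part
   of the solid cone over [A] inside the ball; e.g. the total mass is
   [n / r * vol (eball r)], and for [n = 1] it is the counting measure on
   [{-r, r}]. *)
Definition sphere_measure r (A : set 'rV[R]_n) : \bar R :=
  ((n%:R / r)%:E * lebesgue_rV n (radial_proj r @^-1` A `&` eball r))%E.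

Let sphere_measure_exists r :
  exists mu : {measure set 'rV[R]_n -> \bar R}, sphere_measure r = mu.
Proof.
have [r0|r0] := leP 0 r.
  have nr0 : 0 <= n%:R / r by rewrite divr_ge0.
  by exists (mscale (NngNum nr0)
    (measure_function_pushforward__canonical__measure_function_Measure
      (mrestr (lebesgue_rV n) (measurable_eball r))
      (measurable_radial_proj r))).
exists mzero; apply/funext => A; rewrite /sphere_measure.
rewrite (_ : eball r = set0) ?setI0 ?measure0 ?mule0//.
apply/seteqP; split=> // x /(le_lt_trans)/(_ r0).
by rewrite ltNge sqrtr_ge0.
Qed.

Section instances.
Variable r : R.

Let sphere_measure0 : sphere_measure r set0 = 0%E.
Proof. by have [mu ->] := sphere_measure_exists r; exact: measure0. Qed.

Let sphere_measure_ge0 A : (0 <= sphere_measure r A)%E.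
Proof. by have [mu ->] := sphere_measure_exists r; exact: measure_ge0. Qed.

Let sphere_measure_additive : semi_sigma_additive (sphere_measure r).
Proof.
have [mu ->] := sphere_measure_exists r.
exact: measure_semi_sigma_additive.
Qed.

HB.instance Definition _ := isMeasure.Build _ _ _ (sphere_measure r)
  sphere_measure0 sphere_measure_ge0 sphere_measure_additive.

End instances.

End sphere.

Section smooth.
Variables (R : realType) (V W : normedModType R).

(* [C^k] maps between finite-dimensional spaces: all iterated directional
   derivatives up to order [k] exist and are continuous. *)
Fixpoint Ck (k : nat) (f : V -> W) : Prop :=
  if k is k'.+1 then
    (forall x, differentiable f x) /\ (forall v, Ck k' (fun x => 'D_v f x))
  else continuous f.

Definition smooth (f : V -> W) : Prop := forall k, Ck k f.

End smooth.

Section field_theory.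
Variables (R : realType) (d m N : nat).

(* The arguments of an energy density are the values [phi^a] and the
   derivatives [d_i phi^a], the latter in row [a] and column [i]. *)
Local Notation density := ('cV[R]_m * 'M[R]_(m, d) -> R).
Implicit Types (E : density) (z : 'cV[R]_m * 'M[R]_(m, d)).
Implicit Types (T : 'I_N -> 'M[R]_m) (phi : 'rV[R]_d -> 'cV[R]_m).

Definition dE_field E (a : 'I_m) z : R := 'D_(delta_mx a ord0, 0) E z.

Definition dE_grad E (a : 'I_m) (i : 'I_d) z : R := 'D_(0, delta_mx a i) E z.

Definition partial (i : 'I_d) (f : 'rV[R]_d -> R) (x : 'rV[R]_d) : R :=
  'D_(delta_mx ord0 i) f x.

Definition grad phi (x : 'rV[R]_d) : 'M[R]_(m, d) :=
  \matrix_(a, i) partial i (fun y => phi y a ord0) x.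

Definition jet phi (x : 'rV[R]_d) : 'cV[R]_m * 'M[R]_(m, d) :=
  (phi x, grad phi x).

Definition invariant_density E T : Prop :=
  forall (A : 'I_N) z,
    \sum_a dE_field E a z * (T A *m z.1) a ord0 +
    \sum_i \sum_a dE_grad E a i z * (T A *m z.2) a i = 0.

Definition static_eom E phi : Prop :=
  forall (a : 'I_m) (x : 'rV[R]_d),
    \sum_i partial i (fun y => dE_grad E a i (jet phi y)) x =
    dE_field E a (jet phi x).

Definition current E T phi (A : 'I_N) (i : 'I_d) (x : 'rV[R]_d) : R :=
  \sum_a dE_grad E a i (jet phi x) * (T A *m phi x) a ord0.

End field_theory.

(* Main.v *)
Require Import Defs.
From HB Require Import structures.
From mathcomp Require Import all_boot all_order all_algebra.
From mathcomp Require Import all_classical all_reals all_analysis.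
From mathcomp Require Import measurable_realfun ring lra.

Import Order.TTheory GRing.Theory Num.Theory.
Import numFieldNormedType.Exports.

Set Implicit Arguments.
Unset Strict Implicit.
Unset Printing Implicit Defensive.

Local Open Scope classical_set_scope.
Local Open Scope ring_scope.

(** The equations of motion and the invariance of the density make the current
    [J] divergence free, so [div (x^k J) = J^k].  Let [eta_r] be a C^1 radial
    cutoff equal to 1 on [|x| <= r] and to 0 where [|x|^2 >= 2 r^2].  Integrating
    [div (eta_r x^k J)], one coordinate at a time by Fubini and the fundamental
    theorem of calculus, gives [int eta_r J^k = int w_r(|x|) x^k (x/|x| . J) dx]
    with [w_r] of size at most [8 / r] and supported in [r <= |x| <= 2 r].  In polar
    coordinates the right-hand side is a bounded average over [r <= rho <= 2 r] of
    the flux of [x^k J] through the sphere of radius [rho], hence tends to 0, while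
    the left-hand side tends to [int J^k] by dominated convergence. *)

(** * Lebesgue measure on row vectors *)

(** The hypotheses control the flux only through spheres and only in the limit, and [x^k J] is not
    assumed integrable, so the argument works with compactly supported fields instead of a
    divergence theorem on balls. The cutoff is radial so that its gradient is parallel to [x]: the
    error term is then made of exactly the sphere integrals of the boundary hypothesis. The surface
    measure is given by its cone formula, so polar coordinates require no parametrization of the
    sphere; they follow from Tonelli and the behaviour of Lebesgue measure under dilations. They are
    proved for nonnegative integrands, whereas the flux has no sign and its integral over a
    particular sphere may be infinite or a difference of infinities. Positive and negative parts are
    therefore treated separately, and finiteness on spheres is used only beyond the radius that the
    limit provides. *)

Section lebesgue_rV_theory.
Context {R : realType}.
Local Open Scope ereal_scope.

Local Notation mu := (@lebesgue_measure R).

Let transfer n :=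
  @ge0_integral_pushforward _ _ (measurableTypeR R * 'rV[R]_n)%type
    'rV[R]_n.+1 R _ (@measurable_cons_rV R n) (mu \x lebesgue_rV n) setT.

Lemma measurable_cons_rVr n (a : R) :
  measurable_fun [set: 'rV[R]_n] (fun v => cons_rV (a, v)).
Proof.
by apply: measurableT_comp; [exact: measurable_cons_rV|exact: pair1_measurable].
Qed.

Lemma ge0_integral_rVS n (f : 'rV[R]_n.+1 -> \bar R) :
  measurable_fun setT f -> (forall x, 0 <= f x) ->
  \int[lebesgue_rV n.+1]_x f x =
  \int[mu]_a \int[lebesgue_rV n]_v f (cons_rV (a, v)).
Proof.
move=> mf f0; have /= := transfer measurableT mf (fun y _ => f0 y).
move=> ->; rewrite preimage_setT fubini_tonelli1//=.
by apply: measurableT_comp => //; exact: measurable_cons_rV.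
Qed.

Lemma integrable_rVS n (f : 'rV[R]_n.+1 -> \bar R) :
  (lebesgue_rV n.+1).-integrable setT f ->
  (mu \x lebesgue_rV n).-integrable setT (f \o @cons_rV R n).
Proof.
move=> /integrableP[mf foo]; apply/integrableP; split.
  by apply: measurableT_comp => //; exact: measurable_cons_rV.
apply: le_lt_trans foo.
rewrite (transfer (f := fun x => `|f x|) measurableT _ _)//.
exact: measurableT_comp.
Qed.

Let integral_cons_rV n (f : 'rV[R]_n.+1 -> \bar R) :
  (lebesgue_rV n.+1).-integrable setT f ->
  \int[lebesgue_rV n.+1]_x f x = \int[mu \x lebesgue_rV n]_p f (cons_rV p).
Proof.
move=> intf; have intg := integrable_rVS intf.
have /= := @integral_pushforward _ _ (measurableTypeR R * 'rV[R]_n)%type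
  'rV[R]_n.+1 R _ (@measurable_cons_rV R n) (mu \x lebesgue_rV n) setT f
  (measurable_int _ intf) intg measurableT.
by rewrite preimage_setT.
Qed.

Lemma integral_rVS n (f : 'rV[R]_n.+1 -> \bar R) :
  (lebesgue_rV n.+1).-integrable setT f ->
  \int[lebesgue_rV n.+1]_x f x =
  \int[mu]_a \int[lebesgue_rV n]_v f (cons_rV (a, v)).
Proof.
move=> intf; rewrite integral_cons_rV//.
by rewrite -(integral12_prod_meas1 (integrable_rVS intf)).
Qed.

Lemma integral_rVS_exchange n (f : 'rV[R]_n.+1 -> \bar R) :
  (lebesgue_rV n.+1).-integrable setT f ->
  \int[lebesgue_rV n.+1]_x f x =
  \int[lebesgue_rV n]_v \int[mu]_a f (cons_rV (a, v)).
Proof.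
move=> intf; rewrite integral_cons_rV//.
by rewrite -(integral21_prod_meas1 (integrable_rVS intf)).
Qed.

(** The image of [mu] under multiplication by [c], multiplied by [c], gives every half-open interval
    its length, so it is [mu] by uniqueness. The formula is then a change of variables. *)
Lemma ge0_integral_lebesgue_scale (c : R) (f : R -> \bar R) : (0 < c)%R ->
  measurable_fun setT f -> (forall x, 0 <= f x) ->
  \int[mu]_x f (c * x)%R = c^-1%:E * \int[mu]_x f x.
Proof.
move=> c0 mf f0.
have mc : measurable_fun [set: measurableTypeR R]
    ( *%R c : _ -> measurableTypeR R).
  exact: mulrl_measurable.
have cge0 : (0 <= c)%R by exact: ltW.
pose m : {measure set (measurableTypeR R) -> \bar R} :=
  mscale (NngNum cge0)
    (measure_function_pushforward__canonical__measure_function_Measure mu mc).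
have muE A : measurable A -> mu A = m A.
  apply: lebesgue_measure_unique => /= X [[a b] _ <-] /=.
  rewrite /m /= /mscale /= /pushforward.
  rewrite (_ : _ @^-1` _ = `](a / c)%R, (b / c)%R]%classic); last first.
    apply/seteqP; split => x /=; rewrite !in_itv/= ltr_pdivrMr// ler_pdivlMr//;
      by rewrite mulrC.
  rewrite !lebesgue_measure_itv/= !lte_fin ltr_pM2r ?invr_gt0//.
  case: ifP => _; last by rewrite mule0.
  by rewrite -!EFinD -EFinM; congr EFin; field; rewrite gt_eqF.
rewrite [X in _ = _ * X](eq_measure_integral m); last first.
  by move=> A mA _; exact: muE.
rewrite /m [X in _ = _ * X]ge0_integral_mscale//=.
have /= tr := @ge0_integral_pushforward _ _ _ _ R _ mc mu setT f measurableT mf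
  (fun y _ => f0 y).
rewrite [X in _ = _ * (_ * X)]tr.
by rewrite preimage_setT muleA -EFinM mulVf ?gt_eqF// mul1e.
Qed.

Lemma cons_rVZ n (c : R) (p : R * 'rV[R]_n) :
  (c *: cons_rV p = cons_rV (c * p.1, c *: p.2))%R.
Proof. by have := scale_row_mx c p.1%:M%R p.2; rewrite scale_scalar_mx. Qed.

Lemma measurable_scale_rV n (c : R) :
  measurable_fun setT (fun x : 'rV[R]_n => c *: x)%R.
Proof.
apply: measurable_fun_rV => i.
under eq_fun do rewrite mxE.
by apply: measurable_funM => //; exact: measurable_coord.
Qed.

(** By Tonelli each coordinate contributes one factor [c^-1]. *)
Lemma ge0_integral_rV_scale n (c : R) (f : 'rV[R]_n -> \bar R) : (0 < c)%R ->
  measurable_fun setT f -> (forall x, 0 <= f x) ->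
  \int[lebesgue_rV n]_x f (c *: x)%R =
  (c^-1 ^+ n)%:E * \int[lebesgue_rV n]_x f x.
Proof.
move=> c0; elim: n f => [|n IH] f mf f0.
  rewrite expr0 mul1e; apply: eq_integral => x _; congr f.
  by apply/matrixP => i [].
have mfc : measurable_fun setT (fun x : 'rV[R]_n.+1 => f (c *: x)%R).
  by apply: measurableT_comp => //; exact: measurable_scale_rV.
have mfp :
    measurable_fun [set: measurableTypeR R * 'rV[R]_n] (f \o @cons_rV R n).
  by apply: measurableT_comp => //; exact: measurable_cons_rV.
rewrite !ge0_integral_rVS//.
pose g a := \int[lebesgue_rV n]_v f (cons_rV (a, v)).
have g0 a : 0 <= g a by exact: integral_ge0.
have mg : measurable_fun setT g.
  exact: (@measurable_fun_fubini_tonelli_F _ _ (measurableTypeR R) 'rV[R]_n R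
    (lebesgue_rV n) (f \o @cons_rV R n) mfp (fun x => f0 _)).
transitivity (\int[mu]_a ((c^-1 ^+ n)%:E * g (c * a)%R)).
  apply: eq_integral => a _; rewrite /g -IH//.
  - by apply: eq_integral => v _; rewrite cons_rVZ.
  - exact: (measurableT_comp mf (measurable_cons_rVr _)).
have mgc : measurable_fun [set: measurableTypeR R] (fun a => g (c * a)%R).
  by apply: (measurableT_comp mg); exact: mulrl_measurable.
have cn0 : 0 <= (c^-1 ^+ n)%:E by rewrite lee_fin exprn_ge0// invr_ge0 ltW.
rewrite (ge0_integralZl mu measurableT mgc (fun a _ => g0 _) cn0).
rewrite (ge0_integral_lebesgue_scale c0 mg g0).
by rewrite muleA -EFinM exprSr.
Qed.

End lebesgue_rV_theory.

(** * Polar coordinates *)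

Section polar.
Context {R : realType}.
Local Open Scope ereal_scope.

Local Notation mu := (@lebesgue_measure R).

Lemma ge0_integral_mrestr d (T : measurableType d)
    (m : {measure set T -> \bar R}) (D : set T) (mD : measurable D)
    (f : T -> \bar R) :
  measurable_fun setT f -> (forall x, 0 <= f x) ->
  \int[mrestr m mD]_x f x = \int[m]_(x in D) f x.
Proof.
move=> mf f0.
have -> : \int[m]_(x in D) f x = \int[mrestr m mD]_(x in D) f x.
  apply: eq_measure_integral => A mA AD.
  by have /= E := setIidl AD; have -> : m A = m (A `&` D) by rewrite E.
have mDC : measurable (~` D) by exact: measurableC.
have N0 : mrestr m mD (~` D) = 0 by rewrite /mrestr setICl measure0.
have := @ge0_negligible_integral _ _ _ (mrestr m mD) setT _ f mDC measurableT
  mf (fun x _ => f0 x) N0.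
by rewrite setTD setCK.
Qed.

Lemma measurable_inv : measurable_fun [set: R] (@GRing.inv R).
Proof.
(* [x^-1 = x / |x|^2], a product of measurable functions; at 0 the convention [0^-1 = 0] agrees with
   the leading factor [x]. *)
rewrite (_ : GRing.inv = fun x : R => (x * (`|x| `^ (-1)) ^+ 2)%R).
  apply: measurable_funM => //; apply: measurable_funX.
  by apply: (measurableT_comp (measurable_powR _)); exact: normr_measurable.
apply/funext => x; rewrite powR_inv1// exprVn real_normK ?num_real//.
have [->|x0] := eqVneq x 0%R; first by rewrite invr0 mul0r.
by field.
Qed.

Section enorm_theory.
Variable n : nat.
Implicit Types x : 'rV[R]_n.
Local Open Scope ring_scope.

Lemma enorm_ge0 x : 0 <= enorm x. Proof. exact: sqrtr_ge0. Qed.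

Lemma sqr_enorm x : enorm x ^+ 2 = \sum_i x ord0 i ^+ 2.
Proof. by rewrite sqr_sqrtr// sumr_ge0// => i _; exact: sqr_ge0. Qed.

Lemma enorm_eq0 x : (enorm x == 0) = (x == 0).
Proof.
apply/idP/eqP => [/eqP x0|->]; last first.
  by rewrite /enorm big1 ?sqrtr0// => i _; rewrite mxE expr0n.
have /eqP := sqr_enorm x; rewrite x0 expr0n/= eq_sym psumr_eq0; last first.
  by move=> i _; exact: sqr_ge0.
move=> /allP h; apply/rowP => i; rewrite mxE; apply/eqP.
by rewrite -sqrf_eq0; exact: h (mem_index_enum i).
Qed.

Lemma enormZ (c : R) x : 0 <= c -> enorm (c *: x) = c * enorm x.
Proof.
move=> c0; rewrite /enorm; under eq_bigr do rewrite mxE exprMn.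
by rewrite -mulr_sumr sqrtrM ?sqr_ge0// sqrtr_sqr ger0_norm.
Qed.

Lemma enorm_radial_proj (r : R) x : 0 <= r -> x != 0 ->
  enorm (radial_proj r x) = r.
Proof.
move=> r0 x0; rewrite /radial_proj enormZ ?divr_ge0 ?enorm_ge0//.
by rewrite divfK// enorm_eq0.
Qed.

End enorm_theory.

Lemma measurable_set_neq0 n : measurable [set~ (0%R : 'rV[R]_n)].
Proof.
rewrite (_ : [set~ _] = @enorm R n @^-1` [set~ 0%R]).
  rewrite -[X in measurable X]setTI; apply: measurable_enorm => //.
  exact: measurableC.
by apply/seteqP; split => x /= /eqP h; apply/eqP; move: h; rewrite enorm_eq0.
Qed.

(** [radial_proj r] sends every nonzero point onto the sphere and fixes the origin, so cutting [g]
    off at 0 has the same effect as restricting it to [esphere r]. *)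
Lemma ge0_integral_sphere_measure n (r : R) (g : 'rV[R]_n -> \bar R) :
  (0 < r)%R -> measurable_fun setT g -> (forall x, 0 <= g x) ->
  \int[sphere_measure r]_(x in esphere r) g x =
  (n%:R / r)%:E *
  \int[lebesgue_rV n]_(x in eball r) (g \_ [set~ 0%R]) (radial_proj r x).
Proof.
move=> r0 mg g0.
have nr0 : (0 <= n%:R / r)%R by rewrite divr_ge0// ltW.
have m0 := @measurable_set_neq0 n.
have mr := measurable_radial_proj (R := R) (n := n) r.
have mg0 : measurable_fun setT (g \_ [set~ 0%R]).
  by apply/(measurable_restrictT _ m0); exact: measurable_funTS.
pose m := measure_function_pushforward__canonical__measure_function_Measure
  (mrestr (lebesgue_rV n) (measurable_eball (R := R) (n := n) r)) mr.
transitivity (\int[mscale (NngNum nr0) m]_(x in esphere r) g x); first by [].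
rewrite ge0_integral_mscale//; last 2 first.
- exact: measurable_esphere.
- exact: measurable_funTS.
congr (_ * _); rewrite /m ge0_integral_pushforward//; last 2 first.
- exact: measurable_esphere.
- exact: measurable_funTS.
transitivity (\int[mrestr (lebesgue_rV n) (measurable_eball (R := R) (n := n) r)]_x
    (g \_ [set~ 0%R]) (radial_proj r x)).
  rewrite integral_mkcond; apply: eq_integral => x _.
  rewrite /= !patchE; have [->|x0] := eqVneq x 0%R.
    have -> : radial_proj r (0%R : 'rV[R]_n) = 0%R by rewrite /radial_proj scaler0.
    rewrite !memNset//=.
    rewrite /esphere/= /radial_proj scaler0 => /eqP; apply/negP.
    have /eqP -> : enorm (0%R : 'rV[R]_n) == 0%R by rewrite enorm_eq0.
    by rewrite lt_eqF.
  have er := enorm_radial_proj (ltW r0) x0.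
  rewrite !mem_set//= => /eqP; apply/negP.
  by rewrite -enorm_eq0 er gt_eqF.
rewrite ge0_integral_mrestr//.
- exact: measurableT_comp.
- by move=> x; apply: erestrict_ge0.
Qed.

(** The primitive [- t^-n] rises from -1 at [t = 1] to 0 at infinity. *)
Lemma integral_cone_density n : (0 < n)%N ->
  \int[mu]_(t in `[1%R, +oo[) (n%:R / t ^+ n.+1)%:E = 1.
Proof.
move=> n0.
have D (t : R) : (0 < t)%R ->
    is_derive t (1%R : R) (fun t => - (t^-1 ^+ n))%R (n%:R / t ^+ n.+1)%R.
  move=> t0; have tn0 : t != 0%R by rewrite gt_eqF.
  have dV : derivable (fun t : R => t^-1%R) t 1%R.
    by apply: derivableV => //; exact: derivable_id.
  have iV : is_derive t (1%R : R) (fun t : R => t^-1%R) (- t ^- 2)%R.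
    apply: DeriveDef => //.
    by rewrite (@deriveV _ _ id)// derive_id; exact: mulr1.
  rewrite (_ : (fun _ => _) = - ((fun t : R => t^-1) ^+ n))%R; last first.
    by apply/funext => s; rewrite !fctE.
  apply: is_derive_eq.
  rewrite /GRing.scale/=.
  case: n n0 => // n _.
  rewrite -[n.+1.-1]/n exprVn -!exprVn !exprS expr0; by field.
have C (t : R) : (0 < t)%R -> continuous_at t (fun s => n%:R / s ^+ n.+1)%R.
  move=> t0; apply: cvgM; first exact: cvg_cst.
  by apply: cvgV; [rewrite expf_neq0// gt_eqF|exact: exprn_continuous].
rewrite (@ge0_continuous_FTC2y R _ (fun t => - (t^-1 ^+ n))%R 1 0).
- by rewrite invr1 expr1n sub0e EFinN oppeK.
- by move=> x x1; rewrite divr_ge0// exprn_ge0// (le_trans _ x1).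
- apply: continuous_in_subspaceT => x; rewrite inE/= in_itv/= andbT => x1.
  by apply: C; exact: lt_le_trans x1.
- rewrite -oppr0; apply: cvgN.
  have V0 : (t^-1)%R @[t --> +oo%R] --> (0%R : R).
    by apply/gtr0_cvgV0 => //; near=> x; near: x; exact: nbhs_pinfty_gt.
  have := @exprn_continuous R n 0%R.
  by rewrite /continuous_at expr0n gtn_eqF// => /(cvg_comp _ _ V0).
- by move=> x x1; have := D x (lt_trans ltr01 x1) => -[].
- apply: cvg_at_right_filter.
  have [/derivable1_diffP/differentiable_continuous c1 _] := D 1%R ltr01.
  exact: c1.
- move=> x; rewrite in_itv/= andbT => x1.
  have := D x (lt_trans ltr01 x1) => -[_]; by rewrite derive1E.
Unshelve. all: by end_near. Qed.

Section polar_coordinates.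
Variables (n : nat) (g : 'rV[R]_n -> \bar R).
Hypotheses (n0 : (0 < n)%N) (mg : measurable_fun setT g).
Hypothesis g0 : forall x, 0 <= g x.

Let g' := g \_ [set~ 0%R].

Let g'0 x : 0 <= g' x. Proof. exact: erestrict_ge0. Qed.

Let mg' : measurable_fun setT g'.
Proof.
by apply/(measurable_restrictT _ (@measurable_set_neq0 n)); exact: measurable_funTS.
Qed.

(** The cone formula for the sphere of radius [p.1], as one integrand in the radius and the point.
    Indicators replace the domains of integration so that Tonelli applies on the whole product. *)
Let h (p : measurableTypeR R * 'rV[R]_n) : \bar R :=
  ((n%:R / p.1) * (0 < p.1)%R%:R * (enorm p.2 <= p.1)%R%:R)%:E *
  g' (radial_proj p.1 p.2).

Let h0 p : 0 <= h p.
Proof.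
rewrite /h mule_ge0// lee_fin mulr_ge0//.
by case: ltP => [p0|_]; rewrite ?mulr0// mulr1 divr_ge0// ltW.
Qed.

Let mh : measurable_fun setT h.
Proof.
have mb (b : measurableTypeR R * 'rV[R]_n -> bool) :
    measurable_fun setT b -> measurable_fun setT (fun p => (b p)%:R : R)%R.
  by move=> mb; exact: (measurableT_comp (f := fun b : bool => b%:R : R) _ mb).
apply: emeasurable_funM.
  apply/measurable_EFinP; apply: measurable_funM.
    apply: measurable_funM.
      apply: measurable_funM => //.
      apply: measurableT_comp; [exact: measurable_inv|exact: measurable_fst].
    apply: mb; apply: measurable_fun_ltr => //; exact: measurable_fst.
  apply: mb; apply: measurable_fun_ler; last exact: measurable_fst.
  by apply: measurableT_comp; [exact: measurable_enorm|exact: measurable_snd].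
apply: (measurableT_comp mg').
apply: measurable_fun_rV => i.
under eq_fun do rewrite mxE.
apply: measurable_funM.
  apply: measurable_funM; first exact: measurable_fst.
  apply: measurableT_comp; first exact: measurable_inv.
  by apply: measurableT_comp; [exact: measurable_enorm|exact: measurable_snd].
apply: (measurableT_comp (f := fun x : 'rV[R]_n => x ord0 i)).
  exact: measurable_coord.
exact: measurable_snd.
Qed.

Let sphereE r : (0 < r)%R ->
  \int[sphere_measure r]_(x in esphere r) g x = \int[lebesgue_rV n]_x h (r, x).
Proof.
move=> r0; rewrite ge0_integral_sphere_measure//.
rewrite -ge0_integralZl//; last 3 first.
- exact: measurable_eball.
- apply: measurable_funTS; apply: (measurableT_comp mg').
  exact: measurable_radial_proj.
- by rewrite lee_fin divr_ge0// ltW.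
rewrite integral_mkcond; apply: eq_integral => x _.
rewrite patchE /h /= r0 mulr1.
have -> : (x \in eball r) = (enorm x <= r)%R by apply/idP/idP; rewrite inE.
by case: ifP => _; rewrite ?mulr1// mulr0 mul0e.
Qed.

Lemma measurable_sphere_integral :
  measurable_fun (`]0%R, +oo[%classic : set (measurableTypeR R))
  (fun r => \int[sphere_measure r]_(x in esphere r) g x).
Proof.
apply: (eq_measurable_fun (fun r => \int[lebesgue_rV n]_x h (r, x))).
  by move=> r; rewrite inE/= in_itv/= andbT => /sphereE.
apply: measurable_funTS; exact: (measurable_fun_fubini_tonelli_F h mh h0).
Qed.

(** Under [r = t * enorm x] the condition [enorm x <= r] becomes [1 <= t], the projected point
    becomes [t *: x], and the Jacobian [enorm x] cancels against [n / r]. At the origin both sides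
    vanish because [g'] does. *)
Let rayE x : \int[mu]_r h (r, x) =
  \int[mu]_(t in `[1%R, +oo[) ((n%:R / t)%:E * g' (t *: x)%R).
Proof.
have mhx : measurable_fun [set: measurableTypeR R] (fun r => h (r, x)).
  by apply: (measurableT_comp mh); exact: pair2_measurable.
have [->|x0] := eqVneq x 0%R.
  rewrite !integral0_eq// => t _.
    by rewrite scaler0 /g' patchE memNset ?mule0//= => /(_ erefl).
  by rewrite /h /radial_proj scaler0 /g' patchE memNset ?mule0//= => /(_ erefl).
have ex0 : (0 < enorm x)%R by rewrite lt0r enorm_ge0 enorm_eq0 x0.
have exV0 : (0 < (enorm x)^-1)%R by rewrite invr_gt0.
transitivity (\int[mu]_t ((enorm x)%:E * h ((enorm x * t)%R, x))).
  rewrite ge0_integralZl//; last 2 first.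
  - by apply: (measurableT_comp mhx); exact: mulrl_measurable.
  - by rewrite lee_fin ltW.
  rewrite (@ge0_integral_lebesgue_scale R _ (fun r => h (r, x)))//.
  by rewrite muleA -EFinM divff ?gt_eqF// mul1e.
rewrite [RHS]integral_mkcond; apply: eq_integral => t _.
rewrite patchE /h /= pmulr_rgt0// ler_pMr//.
have -> : radial_proj (enorm x * t) x = (t *: x)%R.
  by rewrite /radial_proj mulrAC divff ?gt_eqF// mul1r.
have -> : (t \in `[1%R, +oo[%classic) = (1 <= t)%R by rewrite mem_setE in_itv/= andbT.
case: ifP => t1; last by rewrite mulr0 mul0e mule0.
have t0 := lt_le_trans ltr01 t1; rewrite t0 !mulr1 muleA -EFinM.
by congr (_%:E * _); field; rewrite !gt_eqF.
Qed.

(* Substitute [r = t * enorm x] along each ray, then [x -> t *: x] for fixed [t];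
   what is left is the integral of [n / t ^+ n.+1] over [t >= 1], which is 1. *)
Lemma ge0_polar :
  \int[mu]_(r in `]0%R, +oo[) \int[sphere_measure r]_(x in esphere r) g x =
  \int[lebesgue_rV n]_(x in [set~ 0%R]) g x.
Proof.
transitivity (\int[mu]_r \int[lebesgue_rV n]_x h (r, x)).
  rewrite integral_mkcond; apply: eq_integral => r _.
  rewrite patchE mem_setE in_itv/= andbT; case: ifP => r0.
    by rewrite sphereE.
  by rewrite integral0_eq// => x _; rewrite /h /= r0 mulr0 mul0r mul0e.
rewrite (fubini_tonelli (m1 := mu) h mh h0).
under eq_integral do rewrite rayE integral_mkcond.
pose k (p : 'rV[R]_n * measurableTypeR R) :=
  ((fun t => (n%:R / t)%:E * g' (t *: p.1)%R) \_ `[1%R, +oo[) p.2.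
have k0 p : 0 <= k p.
  rewrite /k patchE; case: ifPn => //; rewrite inE/= in_itv/= andbT => p1.
  by rewrite mule_ge0// lee_fin divr_ge0// (le_trans ler01 p1).
have mk : measurable_fun setT k.
  rewrite (_ : k = fun p => ((n%:R / p.2) * (1 <= p.2)%R%:R)%:E *
      g' (p.2 *: p.1)%R); last first.
    apply/funext => -[x t]; rewrite /k patchE mem_setE in_itv/= andbT.
    by case: ifP => _; rewrite ?mulr1// mulr0 mul0e.
  apply: emeasurable_funM.
    apply/measurable_EFinP; apply: measurable_funM.
      apply: measurable_funM => //.
      apply: measurableT_comp; [exact: measurable_inv|exact: measurable_snd].
    apply: (measurableT_comp (f := fun b : bool => b%:R : R)) => //.
    by apply: measurable_fun_ler => //; exact: measurable_snd.
  apply: (measurableT_comp mg'); apply: measurable_fun_rV => i.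
  under eq_fun do rewrite mxE.
  apply: measurable_funM; first exact: measurable_snd.
  apply: (measurableT_comp (f := fun x : 'rV[R]_n => x ord0 i)).
    exact: measurable_coord.
  exact: measurable_fst.
rewrite (fubini_tonelli (m2 := mu) k mk k0) /k /=.
rewrite [RHS]integral_mkcond -/g'.
(* The dilation by [t] contributes [t^-n], which turns the factor [n / t] into [n / t^(n+1)]. *)
transitivity (\int[mu]_(t in `[1%R, +oo[)
    ((n%:R / t ^+ n.+1)%:E * \int[lebesgue_rV n]_x g' x)).
  rewrite [RHS]integral_mkcond; apply: eq_integral => t _.
  rewrite patchE; case: ifPn; last first.
    by move=> /negbTE t1; rewrite integral0_eq// => x _; rewrite patchE t1.
  move=> tA; under eq_integral do rewrite patchE tA.
  move: tA; rewrite inE/= in_itv/= andbT => t1.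
  have t0 : (0 < t)%R := lt_le_trans ltr01 t1.
  rewrite ge0_integralZl//; last 2 first.
  - by apply: (measurableT_comp mg'); exact: measurable_scale_rV.
  - by rewrite lee_fin divr_ge0// ltW.
  rewrite ge0_integral_rV_scale// muleA -EFinM; congr (_%:E * _).
  by rewrite exprVn exprS; field; rewrite expf_neq0 ?gt_eqF.
rewrite ge0_integralZr//; last 3 first.
- apply: measurable_funTS; apply/measurable_EFinP; apply: measurable_funM => //.
  apply: measurableT_comp; [exact: measurable_inv|exact: exprn_measurable].
- move=> t /=; rewrite in_itv/= andbT => t1.
  by rewrite lee_fin divr_ge0// exprn_ge0// (le_trans ler01 t1).
- exact: integral_ge0.
by rewrite integral_cone_density// mul1e.
Qed.

End polar_coordinates.

End polar.

(** * Integrals of partial derivatives *)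

Section line_derivative.
Context {R : realType}.

Local Notation mu := (@lebesgue_measure R).

Lemma cons_rV0 n (p : R * 'rV[R]_n) : cons_rV p ord0 ord0 = p.1.
Proof.
rewrite (_ : ord0 = lshift n (@ord0 0)); last exact: val_inj.
by apply: etrans; [exact: row_mxEl|rewrite mxE eqxx mulr1n].
Qed.

Lemma cons_rVS n (p : R * 'rV[R]_n) j : cons_rV p ord0 (lift ord0 j) = p.2 ord0 j.
Proof.
rewrite (_ : lift ord0 j = rshift 1 j); last exact: val_inj.
exact: row_mxEr.
Qed.

Lemma cons_rVDdelta0 n a t (v : 'rV[R]_n) :
  cons_rV (a, v) + t *: delta_mx ord0 ord0 = cons_rV (a + t, v).
Proof.
apply/rowP => j; rewrite [LHS]mxE [X in _ + X]mxE [X in _ + _ * X]mxE.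
case: (unliftP ord0 j) => [k|] ->.
  by rewrite !cons_rVS/= mulr0 addr0.
by rewrite !cons_rV0/= mulr1.
Qed.

Lemma cons_rVDdeltaS n a t (v : 'rV[R]_n) i :
  cons_rV (a, v) + t *: delta_mx ord0 (lift ord0 i) =
  cons_rV (a, v + t *: delta_mx ord0 i).
Proof.
apply/rowP => j; rewrite [LHS]mxE [X in _ + X]mxE [X in _ + _ * X]mxE.
case: (unliftP ord0 j) => [k|] ->.
  by rewrite !cons_rVS/= !mxE !eqxx/= (inj_eq lift_inj).
by rewrite !cons_rV0/= mulr0 addr0.
Qed.

(** A cube rather than a ball: its nonempty slices along a coordinate are cubes with the same [K],
    which suits the inductions on the dimension. *)
Definition box n (K : R) : set 'rV[R]_n := [set x | forall j, `|x ord0 j| <= K].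

Lemma measurable_box n K : measurable (@box n K).
Proof.
rewrite (_ : box K = \big[setI/setT]_(j < n) [set x : 'rV[R]_n | `|x ord0 j| <= K]).
  apply: bigsetI_measurable => j _.
  rewrite -[X in measurable X]setTI.
  rewrite (_ : [set x : 'rV[R]_n | _] = (fun x : 'rV[R]_n => `|x ord0 j|) @^-1` `]-oo, K]).
    have m : measurable_fun setT (fun x : 'rV[R]_n => `|x ord0 j|).
      apply: (measurableT_comp (f := @Num.norm _ R)); first exact: normr_measurable.
      exact: measurable_coord.
    exact: m.
  by apply/seteqP; split=> x /=; rewrite in_itv.
apply/seteqP; split => x /=.
  by move=> h; rewrite -bigcap_seq => j _ /=.
by rewrite -bigcap_seq => h j; apply: h; rewrite /= mem_index_enum.
Qed.

Lemma lebesgue_box_lty n K : (lebesgue_rV n (@box n K) < +oo)%E.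
Proof.
elim: n => [|n IH].
  by rewrite (_ : lebesgue_rV 0 = dirac (0 : 'rV[R]_0))// diracE ltry.
rewrite (_ : lebesgue_rV n.+1 (box K) =
    (mu \x lebesgue_rV n)%E (@cons_rV R n @^-1` box K))//.
rewrite (_ : _ @^-1` _ = `[- K, K]%classic `*` @box n K).
  rewrite product_measure1E//; last exact: measurable_box.
  apply: lte_mul_pinfty => //; rewrite /= lebesgue_measure_itv/=.
  by case: ifP.
apply/seteqP; split => -[a v] /=.
  move=> h; rewrite in_itv/= -ler_norml; split.
    by have := h ord0; rewrite cons_rV0.
  by move=> j; have := h (lift ord0 j); rewrite cons_rVS.
rewrite in_itv/= -ler_norml => -[ha hv] j.
by case: (unliftP ord0 j) => [k|] ->; rewrite ?cons_rV0// cons_rVS; exact: hv.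
Qed.

Lemma integrable_bounded_box n (v : 'rV[R]_n -> R) (K M : R) :
  measurable_fun setT v -> (forall x, `|v x| <= M) ->
  (forall x, ~ box K x -> v x = 0) ->
  (lebesgue_rV n).-integrable setT (EFin \o v).
Proof.
move=> mv vM v0; have mb := @measurable_box n K.
apply: (@eq_integrable _ _ _ _ _ measurableT ((EFin \o v) \_ (box K))).
  move=> x _; rewrite patchE; case: ifPn => //.
  by rewrite notin_setE => /v0 /= ->.
apply/(integrable_mkcond _ mb).
apply: measurable_bounded_integrable => //.
- exact: lebesgue_box_lty.
- exact: measurable_funTS.
- exists M; split; first exact: num_real.
  by move=> y My x _; apply: le_trans (vM x) (ltW My).
Qed.

Lemma integral_derive_compact (f F : R -> R) (K : R) :
  continuous f -> (forall t, is_derive t (1 : R) F (f t)) ->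
  (forall t, K < `|t| -> f t = 0) -> (forall t, K < `|t| -> F t = 0) ->
  (\int[mu]_t (f t)%:E = 0)%E.
Proof.
move=> cf dF f0 F0.
(* [L] is positive and exceeds [K] whatever the sign of [K], so [F] vanishes at both endpoints [-L]
   and [L]. *)
pose L : R := `|K| + 1.
have KL : K < L by rewrite /L ltr_pwDr// ler_norm.
have L0 : 0 < L by rewrite /L ltr_pwDr.
have nL : `|L| = L by rewrite gtr0_norm.
transitivity (\int[mu]_(t in `[(- L)%R, L]) (f t)%:E)%E.
  rewrite [RHS]integral_mkcond; apply: eq_integral => t _.
  rewrite patchE mem_setE in_itv/= -ler_norml; case: leP => // Lt.
  by rewrite f0//; exact: lt_trans Lt.
rewrite (@continuous_FTC2 _ f F).
- by rewrite !F0 ?normrN ?nL// subee.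
- by rewrite gtrN.
- exact: continuous_subspaceT.
- have cF x : continuous_at x F.
    by apply: differentiable_continuous; apply/derivable1_diffP; have [] := dF x.
  split.
  + by move=> x _; have [] := dF x.
  + by apply: cvg_at_right_filter; exact: cF.
  + by apply: cvg_at_left_filter; exact: cF.
- by move=> x _; rewrite derive1E; have [_] := dF x.
Qed.

(* The hypotheses only involve lines parallel to the [i]-th axis, so that they are
   inherited by the slices [cons_rV (a, _)] and [cons_rV (_, x)]. *)
Lemma integral_line_derive n (i : 'I_n) (u v : 'rV[R]_n -> R) (K M : R) :
  measurable_fun setT v -> (forall x, `|v x| <= M) ->
  (forall x, ~ box K x -> u x = 0) -> (forall x, ~ box K x -> v x = 0) ->
  (forall x, continuous (fun t : R => v (x + t *: delta_mx ord0 i))) ->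
  (forall x t, is_derive t (1 : R) (fun s : R => u (x + s *: delta_mx ord0 i))
     (v (x + t *: delta_mx ord0 i))) ->
  (\int[lebesgue_rV n]_x (v x)%:E = 0)%E.
Proof.
elim: n i u v => [[]//|n IH] i u v mv vM u0 v0 cv dv.
have intv : (lebesgue_rV n.+1).-integrable setT (EFin \o v).
  exact: integrable_bounded_box mv vM v0.
have nbS a (x : 'rV[R]_n) : ~ box K x -> ~ box K (cons_rV (a, x)).
  by move=> + h; apply => j; have := h (lift ord0 j); rewrite cons_rVS.
have nb0 a (x : 'rV[R]_n) : K < `|a| -> ~ box K (cons_rV (a, x)).
  by move=> Ka h; have := h ord0; rewrite cons_rV0/= leNgt Ka.
(* For a later coordinate, slice along the first one and use induction; for the first coordinate,
   exchange the integrals so that it becomes the innermost variable. *)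
have [j|] := unliftP ord0 i => iE; rewrite {i}iE in cv dv *.
  rewrite (integral_rVS intv) integral0_eq// => a _.
  apply: (IH j (fun x => u (cons_rV (a, x))) (fun x => v (cons_rV (a, x)))).
  - by apply: (measurableT_comp mv); exact: measurable_cons_rVr.
  - by move=> x; exact: vM.
  - by move=> x /(nbS a) /u0.
  - by move=> x /(nbS a) /v0.
  - move=> x; under eq_fun do rewrite -cons_rVDdeltaS; exact: cv.
  - move=> x t; under eq_fun do rewrite -cons_rVDdeltaS.
    rewrite -cons_rVDdeltaS; exact: dv.
rewrite (integral_rVS_exchange intv) integral0_eq// => x _.
apply: (@integral_derive_compact _ (fun a => u (cons_rV (a, x))) K).
- have := cv (cons_rV (0, x)); under eq_fun do rewrite cons_rVDdelta0 add0r.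
  by [].
- move=> t; have := dv (cons_rV (0, x)) t.
  by under eq_fun do rewrite cons_rVDdelta0 add0r; rewrite cons_rVDdelta0 add0r.
- by move=> t /(nb0 _ x) /v0.
- by move=> t /(nb0 _ x) /u0.
Qed.

End line_derivative.

Section partial_integral.
Context {R : realType}.

(** The two difference quotients are the same function of the increment. *)
Lemma is_derive_line (V W : normedModType R) (u : V -> W) (e : V) (v : W) x t :
  is_derive (x + t *: e) e u v ->
  is_derive t (1 : R) (fun s : R => u (x + s *: e)) v.
Proof.
have E : (fun h : R => h^-1 *: ((u \o shift (x + t *: e)) (h *: e) - u (x + t *: e))) =
    (fun h : R => h^-1 *: (((fun s : R => u (x + s *: e)) \o shift t) (h *: (1 : R))
      - u (x + t *: e))).
  apply/funext => h /=; congr (_ *: (u _ - _)).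
  by rewrite [h *: 1]mulr1 scalerDl addrCA.
case; rewrite /derivable /derive E => c l.
by apply: DeriveDef; rewrite /derivable /derive.
Qed.

Lemma compact_support_bounded n (v : 'rV[R]_n -> R) K :
  continuous v -> (forall x, ~ box K x -> v x = 0) ->
  exists M, forall x, `|v x| <= M.
Proof.
move=> cv v0.
have cb : compact (@box R n K).
  rewrite (_ : box K = [set x : 'rV[R]_n | forall j, `[- K, K]%classic (x ord0 j)]).
    by apply: (@rV_compact _ _ (fun=> `[- K, K]%classic)) => _; exact: segment_compact.
  by apply/seteqP; split=> x /= h j; have := h j; rewrite /= in_itv/= ler_norml.
have cv' : {within box K, continuous v} by exact: continuous_subspaceT.
have [M [_ MB]] := compact_bounded (continuous_compact cv' cb).
exists (`|M| + 1) => x; have [bx|nbx] := pselect (box K x).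
  by apply: MB; [rewrite ltr_pwDr// ler_norm|exists x].
by rewrite v0// normr0 addr_ge0.
Qed.

(* Difference quotients avoid showing that continuous functions are measurable
   for the sigma-algebra generated by the coordinates. *)
Lemma measurable_derive n (u v : 'rV[R]_n -> R) (e : 'rV[R]_n) :
  measurable_fun setT u -> (forall x, is_derive x e u (v x)) ->
  measurable_fun setT v.
Proof.
move=> mu du.
pose q (m : nat) x := (m.+1%:R : R) * (u (m.+1%:R^-1 *: e + x) - u x).
apply: (@measurable_fun_cvg _ _ _ setT q) => [m|x _].
  apply: measurable_funM => //; apply: measurable_funB => //.
  apply: (measurableT_comp mu); apply: measurable_fun_rV => j.
  under eq_fun do rewrite mxE.
  by apply: measurable_funD => //; exact: measurable_coord.
have [c <-] := du x.
(* The increments [1 / (m + 1)] are never zero, so they converge in the punctured filter where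
   derivatives are taken. *)
have h0 : (@harmonic R) @ \oo --> 0^'.
  move=> A A0.
  have H : \forall m \near \oo, @harmonic R m != 0 -> A (harmonic m).
    exact: (@cvg_harmonic R _ A0).
  change (\forall m \near \oo, A (@harmonic R m)).
  by apply: filterS H => m; apply; rewrite /harmonic invr_eq0 pnatr_eq0.
have := cvg_comp _ _ h0 c; apply: cvg_trans.
by apply: near_eq_cvg; apply: nearW => m; rewrite /q /harmonic /= invrK.
Qed.

Lemma integral_partial n (i : 'I_n) (u v : 'rV[R]_n -> R) (K : R) :
  measurable_fun setT u -> continuous v ->
  (forall x, is_derive x (delta_mx ord0 i) u (v x)) ->
  (forall x, ~ box K x -> u x = 0) -> (forall x, ~ box K x -> v x = 0) ->
  (lebesgue_rV n).-integrable setT (EFin \o v) /\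
  (\int[lebesgue_rV n]_x (v x)%:E = 0)%E.
Proof.
move=> mu cv du u0 v0; have mv := measurable_derive mu du.
have [M vM] := compact_support_bounded cv v0; split.
  exact: integrable_bounded_box mv vM v0.
apply: (integral_line_derive mv vM u0 v0) => [x t|x t].
  apply: continuous_comp; last exact: cv.
  apply: cvgD; first exact: cvg_cst.
  by apply: cvgZl; exact: cvg_id.
exact: is_derive_line.
Qed.
End partial_integral.

(** * The current is of class C^1 and divergence free *)

Section continuity.
Context {R : realType} {T : topologicalType}.
Implicit Types f g : T -> R.

Lemma continuous_add f g :
  continuous f -> continuous g -> continuous (fun x => f x + g x).
Proof. by move=> cf cg x; apply: cvgD; [exact: cf|exact: cg]. Qed.

Lemma continuous_mul f g :
  continuous f -> continuous g -> continuous (fun x => f x * g x).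
Proof. by move=> cf cg x; apply: cvgM; [exact: cf|exact: cg]. Qed.

Lemma continuous_fsum n (F : 'I_n -> T -> R) :
  (forall i, continuous (F i)) -> continuous (fun x => \sum_i F i x).
Proof.
move=> cF; apply: (@continuous_big _ _ +%R 0 xpredT _ _ _ _ (fun i _ => cF i)).
exact: add_continuous.
Qed.

End continuity.

Section smooth_maps.
Context {R : realType} {V : normedModType R}.

Lemma CkW (W : normedModType R) k (f : V -> W) : Ck k.+1 f -> Ck k f.
Proof.
elim: k f => [f [df _] x|k IH f [df cf]].
  by apply: differentiable_continuous; exact: df.
by split=> // v; exact: IH (cf v).
Qed.

Lemma Ck_entry k p q (f : V -> 'M[R]_(p, q)) a b :
  Ck k f -> Ck k (fun x => f x a b).
Proof.
elim: k f => [|k IH] f /=.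
  by move=> cf x; apply: (@continuous_comp _ _ _ f (fun N : 'M[R]_(p, q) => N a b));
    [exact: cf|exact: coord_continuous].
move=> [df cDf]; split => [x|v].
  exact: (@differentiable_comp _ _ _ _ f (fun N : 'M[R]_(p, q) => N a b) x
    (df x) (differentiable_coord _ _ _)).
have -> : (fun x => 'D_v (fun y => f y a b) x) = (fun x => ('D_v f x) a b).
  apply/funext => x; rewrite derive_mx ?mxE//.
  exact: diff_derivable.
exact: IH.
Qed.

Lemma differentiable_mx p q (f : V -> 'M[R]_(p, q)) x :
  (forall a b, differentiable (fun x => f x a b) x) -> differentiable f x.
Proof.
move=> df.
have -> : f = \sum_(a < p) \sum_(b < q) (fun y => f y a b *: delta_mx a b).
  apply/funext => y; rewrite {1}(matrix_sum_delta (f y)) fct_sumE.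
  by apply: eq_bigr => a _; rewrite fct_sumE.
apply: differentiable_sum => a; apply: differentiable_sum => b.
exact: differentiableZl.
Qed.

End smooth_maps.

Section field_theory.
Context {R : realType} {d m : nat}.
Implicit Types (phi : 'rV[R]_d -> 'cV[R]_m) (G : 'cV[R]_m * 'M[R]_(m, d) -> R).

Lemma Ck_field_partial k phi i a :
  Ck k.+1 phi -> Ck k (partial i (fun y => phi y a ord0)).
Proof. by move=> /(@Ck_entry _ _ _ _ _ _ a ord0)[_]; exact. Qed.

Lemma differentiable_grad phi x : Ck 2 phi -> differentiable (grad phi) x.
Proof.
move=> phiS; apply: differentiable_mx => a i.
have -> : (fun y => grad phi y a i) = partial i (fun y => phi y a ord0).
  by apply/funext => y; rewrite mxE.
by have [+ _] := Ck_field_partial i a phiS; exact.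
Qed.

Lemma differentiable_jet phi x : Ck 2 phi -> differentiable (jet phi) x.
Proof.
move=> phiS; apply: differentiable_pair; first by have [+ _] := phiS; exact.
exact: differentiable_grad.
Qed.

(** The partial derivatives of a density are its differential in the [delta_mx] directions, so this
    is linearity of the differential. *)
Lemma diff_densityE G z (c : 'cV[R]_m) (M : 'M[R]_(m, d)) : differentiable G z ->
  'd G z (c, M) = \sum_a c a ord0 * dE_field G a z +
                  \sum_a \sum_i M a i * dE_grad G a i z.
Proof.
move=> dG.
have -> : (c, M) = (c, 0) + (0, M) :> 'cV[R]_m * 'M[R]_(m, d).
  by congr (_, _); rewrite ?addr0 ?add0r.
rewrite linearD; congr (_ + _).
- rewrite {1}(matrix_sum_delta c).
  have -> : (\sum_a \sum_b c a b *: delta_mx a b, 0) =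
      \sum_a c a ord0 *: (delta_mx a ord0, 0) :> 'cV[R]_m * 'M[R]_(m, d).
    apply: injective_projections.
      rewrite (raddf_sum (fst : _ -> 'cV[R]_m)) /=.
      by apply: eq_bigr => a _; rewrite big_ord1.
    rewrite (raddf_sum (snd : _ -> 'M[R]_(m, d))) /= big1// => a _.
    by rewrite scaler0.
  rewrite linear_sum; apply: eq_bigr => a _.
  by rewrite linearZ /dE_field deriveE.
- rewrite {1}(matrix_sum_delta M).
  have -> : (0, \sum_a \sum_i M a i *: delta_mx a i) =
      \sum_a \sum_i M a i *: (0, delta_mx a i) :> 'cV[R]_m * 'M[R]_(m, d).
    apply: injective_projections.
      rewrite (raddf_sum (fst : _ -> 'cV[R]_m)) /= big1// => a _.
      rewrite (raddf_sum (fst : _ -> 'cV[R]_m)) /= big1// => i _.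
      by rewrite scaler0.
    rewrite (raddf_sum (snd : _ -> 'M[R]_(m, d))) /=.
    by apply: eq_bigr => a _; rewrite (raddf_sum (snd : _ -> 'M[R]_(m, d))).
  rewrite linear_sum; apply: eq_bigr => a _.
  rewrite linear_sum; apply: eq_bigr => i _.
  by rewrite linearZ /dE_grad deriveE.
Qed.

(** The jet already contains first derivatives of [phi], hence one more order on [phi] than on [G].
    Expanding the chain rule over basis directions displays the derivative as sums of products of
    continuous functions. *)
Lemma Ck1_comp_jet G phi : Ck 1 G -> Ck 2 phi -> Ck 1 (G \o jet phi).
Proof.
move=> [dG cG] phiS; have dj x := differentiable_jet x phiS.
have cj : continuous (jet phi).
  by move=> x; apply: differentiable_continuous.
split => [x|v]; first exact: differentiable_comp.
have -> : (fun x => 'D_v (G \o jet phi) x) = fun x =>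
    \sum_a 'D_v (fun y => phi y a ord0) x * dE_field G a (jet phi x) +
    \sum_a \sum_i 'D_v (partial i (fun y => phi y a ord0)) x * dE_grad G a i (jet phi x).
  apply/funext => x; rewrite deriveE; last exact: differentiable_comp.
  rewrite diff_comp//=.
  have dphi : differentiable phi x by have [+ _] := phiS; exact.
  have dgrad := differentiable_grad x phiS.
  rewrite (diff_pair dphi dgrad) diff_densityE//=.
  congr (_ + _); apply: eq_bigr => a _.
    by rewrite -deriveE// derive_mx ?mxE//; exact: diff_derivable.
  apply: eq_bigr => i _; congr (_ * _).
  rewrite -deriveE// derive_mx ?mxE//; last exact: diff_derivable.
  by congr ('D_v _ x); apply/funext => y; rewrite mxE.
have cc (H : 'cV[R]_m * 'M[R]_(m, d) -> R) : continuous H -> continuous (H \o jet phi).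
  by move=> cH x; apply: continuous_comp; [exact: cj|exact: cH].
apply: continuous_add; apply: continuous_fsum => a.
  apply: continuous_mul; last exact: (cc (dE_field G a) (cG _)).
  have [_ h] : Ck 1 (fun y => phi y a ord0).
    exact: (CkW (Ck_entry a ord0 phiS)).
  exact: h.
apply: continuous_fsum => i; apply: continuous_mul; last exact: (cc (dE_grad G a i) (cG _)).
by have [_ h] := Ck_field_partial i a phiS; exact: h.
Qed.

End field_theory.

Section Ck1_algebra.
Context {R : realType} {V : normedModType R}.
Implicit Types f g : V -> R.

Lemma derive_mul f g x v : differentiable f x -> differentiable g x ->
  'D_v (fun y => f y * g y) x = 'D_v f x * g x + f x * 'D_v g x.
Proof.
move=> df dg.
rewrite (_ : (fun y => f y * g y) = f * g)// deriveM; try exact: diff_derivable.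
by rewrite addrC [_ *: _]mulrC.
Qed.

Lemma derive_fsum n (h : 'I_n -> V -> R) x v :
  (forall i, differentiable (h i) x) ->
  'D_v (fun y => \sum_i h i y) x = \sum_i 'D_v (h i) x.
Proof.
move=> dh; rewrite (_ : (fun y => _) = \sum_i h i).
  by rewrite derive_sum// => i; exact: diff_derivable.
by apply/funext => y; rewrite fct_sumE.
Qed.

Lemma Ck1M f g : Ck 1 f -> Ck 1 g -> Ck 1 (fun x => f x * g x).
Proof.
move=> Cf Cg; have [df cf] := Cf; have [dg cg] := Cg.
split => [x|v]; first exact: (differentiableM (df x) (dg x)).
under eq_fun do rewrite derive_mul//.
by apply: continuous_add; apply: continuous_mul => //; exact: (@CkW R V R 0).
Qed.

Lemma Ck1_sum n (h : 'I_n -> V -> R) :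
  (forall i, Ck 1 (h i)) -> Ck 1 (fun x => \sum_i h i x).
Proof.
move=> Ch; split => [x|v].
  rewrite (_ : (fun y => _) = \sum_i h i); last first.
    by apply/funext => y; rewrite fct_sumE.
  by apply: differentiable_sum => i; have [+ _] := Ch i; exact.
rewrite (_ : (fun x => _) = fun x => \sum_i 'D_v (h i) x); last first.
  by apply/funext => x; rewrite derive_fsum// => i; have [+ _] := Ch i; exact.
by apply: continuous_fsum => i; have [_ h'] := Ch i; exact: h'.
Qed.

Lemma Ck1_cst (c : R) : Ck 1 (fun _ : V => c).
Proof.
split => [x|v]; first exact: differentiable_cst.
have -> : (fun x => 'D_v (fun _ : V => c) x) = fun=> 0.
  by apply/funext => x; exact: derive_cst.
by move=> x; exact: cvg_cst.
Qed.

End Ck1_algebra.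

Section current.
Context {R : realType} {d m N : nat}.
Variables (E : 'cV[R]_m * 'M[R]_(m, d) -> R) (T : 'I_N -> 'M[R]_m).
Variables (phi : 'rV[R]_d -> 'cV[R]_m).
Hypotheses (E_smooth : smooth E) (phi_smooth : smooth phi).

(** [P] is the momentum conjugate to [d_i phi^a] and [Q] the variation of [phi^a] under the
    generator [T A]; the current is the sum over [a] of [P * Q]. *)
Let P a i x := dE_grad E a i (jet phi x).
Let Q A a x := (T A *m phi x) a ord0.

Let CP a i : Ck 1 (P a i).
Proof.
have [_ /(_ (0, delta_mx a i)) h] : Ck 2 E := E_smooth 2.
exact: (Ck1_comp_jet h (phi_smooth 2)).
Qed.

Let QE A a x : Q A a x = \sum_b T A a b * phi x b ord0.
Proof. by rewrite /Q mxE. Qed.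

Let CQ A a : Ck 1 (Q A a).
Proof.
rewrite (_ : Q A a = fun x => \sum_b T A a b * phi x b ord0); last exact/funext/QE.
apply: Ck1_sum => b; apply: Ck1M; first exact: Ck1_cst.
exact: (Ck_entry b ord0 (phi_smooth 1)).
Qed.

Let partialQ A a i x : partial i (Q A a) x = (T A *m grad phi x) a i.
Proof.
have Cphi b := Ck_entry b ord0 (phi_smooth 1).
rewrite (_ : Q A a = fun x => \sum_b T A a b * phi x b ord0); last exact/funext/QE.
rewrite /partial derive_fsum => [|b]; last first.
  by have [+ _] := Ck1M (Ck1_cst (T A a b)) (Cphi b); exact.
rewrite mxE; apply: eq_bigr => b _; rewrite derive_mul.
- have -> := derive_cst (T A a b) x (delta_mx ord0 i : 'rV[R]_d).
  by rewrite mul0r add0r mxE.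
- exact: differentiable_cst.
- by have [+ _] := Cphi b; exact.
Qed.

Lemma Ck1_current A i : Ck 1 (current E T phi A i).
Proof. by apply: Ck1_sum => a; apply: Ck1M; [exact: CP|exact: CQ]. Qed.

(** Noether's argument: in [d_i (P Q) = (d_i P) Q + P (d_i Q)] the equations of motion turn the sum
    of [d_i P] into [dE_field], and what results is the invariance identity at the jet of [phi]. *)
Lemma current_div_free A x : invariant_density E T -> static_eom E phi ->
  \sum_i partial i (current E T phi A i) x = 0.
Proof.
move=> Einv eom.
have dP a i y : differentiable (P a i) y by have [+ _] := CP a i; exact.
have dQ a y : differentiable (Q A a) y by have [+ _] := CQ A a; exact.
have pJ i : partial i (current E T phi A i) x =
    \sum_a (partial i (P a i) x * Q A a x + P a i x * (T A *m grad phi x) a i).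
  rewrite /partial /current derive_fsum => [|a]; last first.
    exact: (differentiableM (dP a i x) (dQ a x)).
  apply: eq_bigr => a _; rewrite -partialQ.
  exact: (derive_mul _ (dP a i x) (dQ a x)).
under eq_bigr do rewrite pJ big_split/=.
rewrite big_split/= exchange_big/= -[RHS](Einv A (jet phi x)); congr (_ + _).
by apply: eq_bigr => a _; rewrite -mulr_suml -eom.
Qed.

End current.

(** * Radial cutoffs and the flux through spheres *)

Section cutoff.
Context {R : realType}.

(** Also at the kink [c], the difference quotient is within [|h|] of the claimed derivative, by
    cases on the signs of [h + u - c] and [u - c]. *)
Lemma is_derive_sqr_pos (c u : R) :
  is_derive u (1 : R) (fun t => Num.max 0 (t - c) ^+ 2) (2 * Num.max 0 (u - c)).
Proof.
have H : (h^-1 *: (Num.max 0 (h *: (1 : R) + u - c) ^+ 2 - Num.max 0 (u - c) ^+ 2))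
    @[h --> 0^'] --> 2 * Num.max 0 (u - c).
  apply/cvgrPdist_le => e e0; near=> h.
  have h0 : h != 0 by near: h; exact: nbhs_dnbhs_neq.
  have he : `|h| <= e by near: h; exact: dnbhs0_le.
  apply: le_trans he.
  rewrite -(ler_pM2l (x := `|h|)) ?normr_gt0// -normrM mulrBr.
  rewrite /GRing.scale/= mulr1 mulVKf//.
  rewrite -normrM -expr2 [`|h ^+ 2|]ger0_norm ?sqr_ge0// ler_norml.
  rewrite /Num.max; case: ltP => h1; case: ltP => h2; apply/andP; split; nra.
by apply: DeriveDef; [apply/cvg_ex; eexists; exact: H|exact: cvg_lim H].
Unshelve. all: by end_near. Qed.

Lemma exists_cutoff : exists psi tau : R -> R,
  [/\ continuous tau, forall u, is_derive u (1 : R) psi (- tau u),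
      forall u, 0 <= tau u <= 2, forall u, ~~ (0 < u < 1) -> tau u = 0 &
      [/\ forall u, u <= 0 -> psi u = 1, forall u, 1 <= u -> psi u = 0 &
       forall u, `|psi u| <= 1]].
Proof.
(* [tau] is the tent of height 2 over the unit interval. *)
pose q c (u : R) := Num.max 0 (u - c) ^+ 2.
(* The weights 1, -2, 1 at the knots 0, 1/2, 1 form a second difference, which is constant to the
   right of 1; the factor 2 makes [psi] reach 0 there. The resulting [tau] has area 1. *)
pose psi (u : R) := 1 - 2 * (q 0 u + (- 2) * q (2^-1) u + q 1 u).
pose tau (u : R) : R :=
  4 * (Num.max 0 (u - 0) - 2 * Num.max 0 (u - 2^-1) + Num.max 0 (u - 1)).
exists psi, tau; split.
- have cm c : continuous (fun u : R => Num.max 0 (u - c)).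
    move=> u; apply: (@continuous_max _ _ (cst 0) (fun u : R => u - c)); first exact: cvg_cst.
    by apply: cvgB; [exact: cvg_id|exact: cvg_cst].
  move=> u; apply: cvgM; first exact: cvg_cst.
  apply: cvgD; last exact: cm.
  apply: cvgB; first exact: cm.
  by apply: cvgM; [exact: cvg_cst|exact: cm].
- move=> u.
  have Q c : is_derive u (1 : R) (q c) (2 * Num.max 0 (u - c)) by exact: is_derive_sqr_pos.
  rewrite (_ : psi = cst 1 - 2 *: (q 0 + (-2) *: q 2^-1 + q 1)); last first.
    by apply/funext.
  have D := is_deriveB (is_derive_cst (1 : R) u (1 : R)) (is_deriveZ 2
    (is_deriveD (is_deriveD (Q 0) (is_deriveZ (-2) (Q 2^-1))) (Q 1))).
  apply: (is_derive_eq D); rewrite /tau sub0r /GRing.scale/=.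
  ring.
- move=> u; rewrite /tau /Num.max; apply/andP; split;
    do 3 (case: ltP => ?); lra.
- move=> u; rewrite negb_and -!leNgt /tau /Num.max => /orP[] ?;
    do 3 (case: ltP => ?); lra.
- split=> u; rewrite /psi /q /Num.max; do 3 (case: ltP => ?); try lra; try nra.
  all: rewrite ler_norml; apply/andP; split; nra.
Qed.

End cutoff.

Section radial_cutoff.
Context {R : realType}.

Lemma derive_comp1 (V : normedModType R) (psi dpsi : R -> R) (s : V -> R) x v :
  (forall u, is_derive u (1 : R) psi (dpsi u)) -> differentiable s x ->
  'D_v (fun y => psi (s y)) x = dpsi (s x) * 'D_v s x.
Proof.
move=> dp ds; have [dpx dpE] := dp (s x).
have dpd : differentiable psi (s x) by exact/derivable1_diffP.
rewrite (deriveE _ (differentiable_comp ds dpd)) (diff_comp ds dpd) /=.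
by rewrite -(deriveE _ ds) (deriv1E dpx) derive1E dpE mulrC.
Qed.

Lemma Ck1_comp1 (V : normedModType R) (psi dpsi : R -> R) (s : V -> R) :
  (forall u, is_derive u (1 : R) psi (dpsi u)) -> continuous dpsi ->
  Ck 1 s -> Ck 1 (fun y => psi (s y)).
Proof.
move=> dp cdp Cs; have [ds cs] := Cs; split => [x|v].
  apply: (differentiable_comp (ds x)); apply/derivable1_diffP.
  by have [] := dp (s x).
under eq_fun do rewrite (derive_comp1 _ dp (ds _)).
apply: continuous_mul; last exact: cs.
move=> x; apply: continuous_comp; last exact: cdp.
exact: (@CkW R V R 0).
Qed.

Section coordinates.
Variable n : nat.
Implicit Types x v : 'rV[R]_n.

Lemma derive_coord k x v : 'D_v (fun y : 'rV[R]_n => y ord0 k) x = v ord0 k.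
Proof.
have := @derive_mx R _ 1 n id x v (@derivable_id _ _ x v).
by rewrite derive_id => /matrixP/(_ ord0 k); rewrite mxE.
Qed.

Lemma Ck1_coord k : Ck 1 (fun x : 'rV[R]_n => x ord0 k).
Proof.
split=> [x|v]; first exact: differentiable_coord.
have -> : (fun x => 'D_v (fun y : 'rV[R]_n => y ord0 k) x) = fun=> v ord0 k.
  by apply/funext => x; exact: derive_coord.
exact: (@cst_continuous 'rV[R]_n R).
Qed.

Let sqr_enormE : (fun x => enorm x ^+ 2) = fun x => \sum_i x ord0 i * x ord0 i.
Proof.
by apply/funext => x; rewrite sqr_enorm; apply: eq_bigr => i _; rewrite expr2.
Qed.

Lemma Ck1_sqr_enorm : Ck 1 (fun x : 'rV[R]_n => enorm x ^+ 2).
Proof.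
rewrite sqr_enormE.
by apply: Ck1_sum => i; apply: Ck1M; exact: Ck1_coord.
Qed.

Lemma partial_sqr_enorm i x :
  partial i (fun x : 'rV[R]_n => enorm x ^+ 2) x = 2 * x ord0 i.
Proof.
rewrite /partial sqr_enormE.
have dc (k : 'I_n) (y : 'rV[R]_n) := differentiable_coord y ord0 k.
rewrite derive_fsum => [|k]; last first.
  by have [+ _] := Ck1M (Ck1_coord k) (Ck1_coord k); exact.
rewrite (bigD1 i)//= big1 => [|k ki]; last first.
  rewrite (derive_mul _ (dc k x) (dc k x)) !derive_coord.
  by rewrite mxE (negbTE ki) mulr0 mul0r addr0.
by rewrite (derive_mul _ (dc i x) (dc i x)) !derive_coord mxE !eqxx/=; ring.
Qed.

Lemma enorm_box r x : enorm x <= r -> box r x.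
Proof.
move=> xr j; apply: le_trans xr.
rewrite -ler_sqr ?nnegrE ?enorm_ge0// sqr_enorm real_normK ?num_real//.
by rewrite (bigD1 j)//= lerDl sumr_ge0// => i _; exact: sqr_ge0.
Qed.

End coordinates.

End radial_cutoff.

(** * Integrating the divergence of the cut-off field *)

Section weighted_flux.
Context {R : realType} {n : nat}.
Variables (J : 'I_n -> 'rV[R]_n -> R) (k : 'I_n).
Hypotheses (CJ : forall i, Ck 1 (J i)).
Hypotheses (mJ : forall i, measurable_fun setT (J i)).
Hypothesis IJ : (lebesgue_rV n).-integrable setT (EFin \o J k).
Hypothesis divJ : forall x, \sum_i partial i (J i) x = 0.
Variables (psi tau : R -> R) (r : R).
Hypotheses (ctau : continuous tau).
Hypotheses (dpsi : forall u, is_derive u (1 : R) psi (- tau u)).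
Hypotheses (tau0 : forall u, ~~ (0 < u < 1) -> tau u = 0).
Hypotheses (psi0 : forall u, 1 <= u -> psi u = 0).
Hypotheses (psi1 : forall u, `|psi u| <= 1) (r0 : 0 < r).

(* The division by [enorm x] gives 0 at the origin. *)
Definition radial_flux (x : 'rV[R]_n) :=
  x ord0 k * \sum_i x ord0 i / enorm x * J i x.

(** The squared norm is a polynomial, so the cutoff is C^1 at the origin too. The argument is 0 at
    [enorm x = r] and reaches 1 where the squared norm is [2 r^2]. *)
Definition cutoff x := psi (enorm (x : 'rV[R]_n) ^+ 2 / r ^+ 2 - 1).

(** Minus the derivative of the cutoff with respect to the radius [rho]. *)
Definition shell_weight rho := tau (rho ^+ 2 / r ^+ 2 - 1) * (2 * rho / r ^+ 2).

Let aff (u : R) := r ^- 2 * u + (- 1).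

Let daff u : is_derive u (1 : R) aff (r ^- 2).
Proof.
have D := is_deriveD (is_deriveZ (r ^- 2) (is_derive_id u (1 : R)))
  (is_derive_cst (-1 : R) u (1 : R)).
by apply: (is_derive_eq D); rewrite addr0; exact: mulr1.
Qed.

Let sq (x : 'rV[R]_n) := aff (enorm x ^+ 2).

Let sqE x : enorm x ^+ 2 / r ^+ 2 - 1 = sq x.
Proof. by rewrite /sq /aff mulrC. Qed.

Let Csq : Ck 1 sq.
Proof.
apply: (Ck1_comp1 daff); last exact: Ck1_sqr_enorm.
exact: (@cst_continuous R R).
Qed.

Let dsq i x : partial i sq x = 2 * x ord0 i / r ^+ 2.
Proof.
have [+ _] := @Ck1_sqr_enorm R n => /(_ x) ds.
by rewrite /partial (derive_comp1 _ daff ds) -/(partial i _ x) partial_sqr_enorm mulrC.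
Qed.

Let cndtau : continuous (fun u => - tau u).
Proof. by move=> u; apply: cvgN; exact: ctau. Qed.

Let Ccut : Ck 1 cutoff.
Proof.
rewrite (_ : cutoff = fun x => psi (sq x)).
  exact: (Ck1_comp1 dpsi cndtau Csq).
by apply/funext => x; rewrite /cutoff sqE.
Qed.

Let dcut i x : partial i cutoff x = - (tau (sq x) * (2 * x ord0 i / r ^+ 2)).
Proof.
have [+ _] := Csq => /(_ x) ds.
rewrite /partial (_ : cutoff = fun x => psi (sq x)); last first.
  by apply/funext => y; rewrite /cutoff sqE.
by rewrite (derive_comp1 _ dpsi ds) mulNr -/(partial i sq x) dsq.
Qed.

Let sq1 x : ~ box (2 * r) x -> 1 <= sq x.
Proof.
move=> nbx; have : 2 * r < enorm x.
  by rewrite ltNge; apply/negP => /enorm_box.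
move=> rx; rewrite -sqE lerBrDr ler_pdivlMr ?exprn_gt0//.
rewrite (@le_trans _ _ ((2 * r) ^+ 2))//; first by nra.
by rewrite ler_sqr ?nnegrE ?enorm_ge0// ?ltW// mulr_gt0.
Qed.

Let cut0 x : ~ box (2 * r) x -> cutoff x = 0.
Proof. by move=> /sq1; rewrite /cutoff sqE; exact: psi0. Qed.

Let dcut0 i x : ~ box (2 * r) x -> partial i cutoff x = 0.
Proof.
move=> /sq1 h; rewrite dcut tau0 ?mul0r ?oppr0//.
by rewrite negb_and -!leNgt h orbT.
Qed.

Lemma measurable_cutoff : measurable_fun setT cutoff.
Proof.
have cpsi : continuous psi.
  move=> u; apply: differentiable_continuous; apply/derivable1_diffP.
  by have [] := dpsi u.
apply: (measurableT_comp (continuous_measurable_fun cpsi)).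
apply: measurable_funB => //; apply: measurable_funM => //.
by apply: measurable_funX; exact: measurable_enorm.
Qed.

Let F i (x : 'rV[R]_n) := x ord0 k * J i x.

Let CF i : Ck 1 (F i). Proof. exact: (Ck1M (@Ck1_coord R n k) (CJ i)). Qed.

Let mF i : measurable_fun setT (F i).
Proof. by apply: measurable_funM => //; exact: measurable_coord. Qed.

Let G i (x : 'rV[R]_n) :=
  partial i cutoff x * F i x + cutoff x * partial i (F i) x.

Let intG i : (lebesgue_rV n).-integrable setT (EFin \o G i) /\
  (\int[lebesgue_rV n]_x (G i x)%:E = 0)%E.
Proof.
have [dc cc] := Ccut; have [df cf] := CF i.
have GE : G i = partial i (fun x => cutoff x * F i x).
  by apply/funext => x; rewrite [RHS](derive_mul _ (dc x) (df x)).
have [du cu] := Ck1M Ccut (CF i).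
apply: (@integral_partial R n i (fun x => cutoff x * F i x) (G i) (2 * r)).
- by apply: measurable_funM => //; exact: measurable_cutoff.
- by rewrite GE; exact: cu.
- move=> x; rewrite GE; apply: DeriveDef => //; exact: diff_derivable.
- by move=> x bx; rewrite cut0// mul0r.
- by move=> x bx; rewrite /G cut0// dcut0// !mul0r addr0.
Qed.

Let sumF x : \sum_i partial i (F i) x = J k x.
Proof.
have [dk _] := @Ck1_coord R n k.
under eq_bigr => i _.
  have [dJ _] := CJ i.
  rewrite /partial (derive_mul _ (dk x) (dJ x)) derive_coord.
  over.
rewrite big_split/= -mulr_sumr divJ mulr0 addr0 (bigD1 k)//= big1.
  by rewrite mxE !eqxx mul1r addr0.
by move=> i ik; rewrite mxE eq_sym (negbTE ik) mul0r.
Qed.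

Let sumG x :
  \sum_i G i x = cutoff x * J k x - shell_weight (enorm x) * radial_flux x.
Proof.
rewrite big_split/= -mulr_sumr sumF addrC; congr (_ + _).
(* At the origin the flux terms contain the factor [x^k = 0]; elsewhere [enorm x] can be
   cancelled. *)
have [->|x0] := eqVneq x 0.
  rewrite big1 => [|i _]; last by rewrite /F mxE mul0r mulr0.
  by rewrite /radial_flux mxE mul0r mulr0 oppr0.
rewrite /shell_weight /radial_flux sqE mulrA -mulNr mulr_sumr.
apply: eq_bigr => i _; rewrite dcut /F.
have ex0 : enorm x != 0 by rewrite enorm_eq0.
by field; rewrite ex0 gt_eqF.
Qed.

Lemma integrable_cutoff :
  (lebesgue_rV n).-integrable setT (fun x => (cutoff x * J k x)%:E).
Proof.
apply: (integrableMr _ measurable_cutoff _ IJ) => //.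
by exists 1; split => // M M1 x _; apply: le_trans (psi1 _) (ltW M1).
Qed.

(** The weighted flux is [cutoff * J^k] minus the divergence of the cut-off field. Both are
    integrable, so it is as well, and the divergence integrates to 0. *)
Lemma weighted_flux :
  (lebesgue_rV n).-integrable setT
    (fun x => (shell_weight (enorm x) * radial_flux x)%:E) /\
  (\int[lebesgue_rV n]_x (shell_weight (enorm x) * radial_flux x)%:E =
   \int[lebesgue_rV n]_x (cutoff x * J k x)%:E)%E.
Proof.
have iG : (lebesgue_rV n).-integrable setT (fun x => (\sum_i (G i x)%:E)%E).
  by apply: integrable_sum => // i _; have [] := intG i.
have iG0 : (\int[lebesgue_rV n]_x (\sum_i (G i x)%:E) = 0)%E.
  rewrite integral_sum// => [|i]; last by have [] := intG i.
  by rewrite big1// => i _; have [] := intG i.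
have E : (fun x => (shell_weight (enorm x) * radial_flux x)%:E) =
    ((fun x => (cutoff x * J k x)%:E) \- (fun x => (\sum_i (G i x)%:E)%E))%E.
  by apply/funext => x; rewrite sumEFin sumG -EFinB subKr.
have ic := integrable_cutoff.
split; first by rewrite E; exact: integrableB.
by rewrite E integralB// iG0 sube0.
Qed.

End weighted_flux.

(** * Bounding a signed radially weighted integral by sphere integrals *)

Section polar_bound.
Context {R : realType} {n : nat}.
Local Open Scope ereal_scope.
Local Notation mu := (@lebesgue_measure R).

Lemma ge0_integral_sphere_radial (w : R -> R) (f : 'rV[R]_n -> \bar R) rho :
  (0 <= w rho)%R -> measurable_fun setT f -> (forall x, 0 <= f x) ->
  \int[sphere_measure rho]_(x in esphere rho) ((w (enorm x))%:E * f x) =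
  (w rho)%:E * \int[sphere_measure rho]_(x in esphere rho) f x.
Proof.
move=> w0 mf f0; rewrite -ge0_integralZl//.
- by apply: eq_integral => x; rewrite inE /esphere/= => ->.
- exact: measurable_esphere.
- exact: measurable_funTS.
Qed.

(** Polar coordinates are applied to the positive and negative parts, and [w], constant on spheres,
    is pulled out. Recombining them inside [w rho] needs finite sphere integrals, unless [w rho = 0]
    removes both; this is the disjunction in the last hypothesis. *)
Lemma abse_integral_polar_le (w b : R -> R) (f : 'rV[R]_n -> R) :
  (0 < n)%N -> measurable_fun setT f -> measurable_fun setT b ->
  (forall rho, 0 <= rho -> 0 <= w rho)%R -> w 0%R = 0%R ->
  (lebesgue_rV n).-integrable setT (fun x => (w (enorm x) * f x)%:E) ->
  (forall rho, (0 < rho)%R ->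
    let s := \int[sphere_measure rho]_(x in esphere rho) (f x)%:E in
    (w rho = 0%R \/ s \is a fin_num) /\ (w rho)%:E * `|s| <= (b rho)%:E) ->
  `| \int[lebesgue_rV n]_x (w (enorm x) * f x)%:E | <=
  \int[mu]_(rho in `]0%R, +oo[) (b rho)%:E.
Proof.
move=> n0 mf mb w0 w00 intg sb.
set g := fun x => (w (enorm x) * f x)%:E.
pose F := EFin \o f.
pose h (F : 'rV[R]_n -> \bar R) rho :=
  \int[sphere_measure rho]_(x in esphere rho) F x.
have mF : measurable_fun setT F by exact/measurable_EFinP.
have mg : measurable_fun setT g by exact: measurable_int intg.
have gpE x : g^\+ x = (w (enorm x))%:E * F^\+ x.
  by rewrite !funeposE maxe_pMr ?mule0// lee_fin w0// enorm_ge0.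
have gmE x : g^\- x = (w (enorm x))%:E * F^\- x.
  by rewrite !funenegE /g EFinM -muleN maxe_pMr ?mule0// lee_fin w0// enorm_ge0.
(* [ge0_polar] leaves out the origin; [w 0 = 0] makes the integrands vanish there, so nothing is
   lost. *)
have pol (G : 'rV[R]_n -> \bar R) :
    measurable_fun setT G -> (forall x, 0 <= G x) -> G 0%R = 0 ->
    \int[lebesgue_rV n]_x G x = \int[mu]_(rho in `]0%R, +oo[) h G rho.
  move=> mG G0 G00; rewrite /h ge0_polar// [RHS]integral_mkcond.
  apply: eq_integral => x _; rewrite patchE; case: ifPn => //.
  by rewrite notin_setE/= => /contrapT ->.
have en0 : enorm (0%R : 'rV[R]_n) = 0%R by apply/eqP; rewrite enorm_eq0.
have mgp : measurable_fun setT g^\+ by exact: measurable_funepos.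
have mgm : measurable_fun setT g^\- by exact: measurable_funeneg.
have gp0 x : 0 <= g^\+ x by exact: funepos_ge0.
have gm0 x : 0 <= g^\- x by exact: funeneg_ge0.
have gp00 : g^\+ 0%R = 0 by rewrite gpE en0 w00 mul0e.
have gm00 : g^\- 0%R = 0 by rewrite gmE en0 w00 mul0e.
have hint (G : 'rV[R]_n -> \bar R) :
    (forall x, 0 <= G x) -> measurable_fun setT G -> G 0%R = 0 ->
    \int[lebesgue_rV n]_x G x < +oo ->
    mu.-integrable `]0%R, +oo[ (h G).
  move=> G0 mG G00 Goo; apply/integrableP; split.
    exact: measurable_sphere_integral.
  apply: le_lt_trans Goo; rewrite pol//.
  rewrite le_eqVlt; apply/orP; left; apply/eqP; apply: eq_integral => rho _.
  by rewrite gee0_abs//; exact: integral_ge0.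
have hp := hint _ gp0 mgp gp00 (integral_funepos_lt_pinfty measurableT intg).
have hm := hint _ gm0 mgm gm00 (integral_funeneg_lt_pinfty measurableT intg).
rewrite integralE (pol _ mgp)// (pol _ mgm)// -integralB//.
apply: le_trans.
  apply: le_abse_integral => //.
  apply: emeasurable_funB; exact: measurable_sphere_integral.
apply: ge0_le_integral => //.
- by apply: measurableT_comp => //; apply: emeasurable_funB; exact: measurable_sphere_integral.
- by apply/measurable_EFinP; exact: measurable_funTS.
move=> rho; rewrite /= in_itv/= andbT => rho0.
have [] := sb _ rho0; rewrite integralE -/(h F^\+ rho) -/(h F^\- rho) => alt.
have hpE : h g^\+ rho = (w rho)%:E * h F^\+ rho.
  rewrite -ge0_integral_sphere_radial//; last exact: measurable_funepos.
    by apply: eq_integral => x _; rewrite gpE.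
  exact: w0 (ltW rho0).
have hmE : h g^\- rho = (w rho)%:E * h F^\- rho.
  rewrite -ge0_integral_sphere_radial//; last exact: measurable_funeneg.
    by apply: eq_integral => x _; rewrite gmE.
  exact: w0 (ltW rho0).
apply: le_trans; rewrite hpE hmE.
case: alt => [->|fs]; first by rewrite !mul0e subee// abse0.
have pm : h F^\+ rho +? - h F^\- rho.
  by move: fs; rewrite fin_numB => /andP[fp _]; rewrite fin_num_adde_defr.
by rewrite -muleBr// abseM gee0_abs// lee_fin w0// ltW.
Qed.

End polar_bound.

(** * Vanishing integral of a divergence-free field *)

Section div_free.
Context {R : realType} {n : nat}.
Variables (J : 'I_n -> 'rV[R]_n -> R) (k : 'I_n).
Hypotheses (CJ : forall i, Ck 1 (J i)).
Hypothesis IJ : forall i, (lebesgue_rV n).-integrable setT (EFin \o J i).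
Hypothesis divJ : forall x, \sum_i partial i (J i) x = 0.
Hypothesis flux0 :
  (\int[sphere_measure r]_(x in esphere r) (radial_flux J k x)%:E)%E
    @[r --> +oo%R] --> 0%E.

Local Notation mu := (@lebesgue_measure R).

Let mJ i : measurable_fun setT (J i).
Proof. by apply/measurable_EFinP; exact: measurable_int (IJ i). Qed.

Let mflux : measurable_fun setT (radial_flux J k).
Proof.
apply: measurable_funM; first exact: measurable_coord.
apply: measurable_sum => i; apply: measurable_funM => //.
apply: measurable_funM; first exact: measurable_coord.
by apply: measurableT_comp; [exact: measurable_inv|exact: measurable_enorm].
Qed.

Lemma integral_div_free_eq0 : (\int[lebesgue_rV n]_x (J k x)%:E = 0)%E.
Proof.
have n0 : (0 < n)%N by apply: leq_ltn_trans (ltn_ord k).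
have [psi [tau [ctau dpsi taub tau0 [psi1 psi0 psib]]]] := @exists_cutoff R.
have [sfin /cvgrPdist_le s0] := (fine_cvgP _ _).1 flux0.
have bound (e : R) : 0 < e -> \forall r \near +oo%R,
    (`| \int[lebesgue_rV n]_x (cutoff psi r x * J k x)%:E | <= (8 * e)%:E)%E.
  move=> e0; have [M [_ HM]] := filterI sfin (s0 e e0).
  near=> r.
  have r0 : 0 < r by near: r; exact: nbhs_pinfty_gt.
  have rM : M < r by near: r; apply: nbhs_pinfty_gt; exact: num_real.
  have [iw <-] := weighted_flux CJ mJ (IJ k) divJ ctau dpsi tau0 psi0 psib r0.
  (* On the shell [tau <= 2] and [2 rho / r^2 <= 4 / r], so the weight is at most [8 / r]; the flux
     is at most [e] and the interval has length [r], whence [8 * e]. *)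
  pose b (rho : R) := 8 * e / r * \1_(`[r, 2 * r]) rho.
  apply: (@le_trans _ _ (\int[mu]_(rho in `]0%R, +oo[) (b rho)%:E)%E); last first.
    rewrite /b; under eq_integral do rewrite EFinM.
    rewrite ge0_integralZl//; last 2 first.
    - apply/measurable_EFinP.
      by apply: measurable_funTS; apply: measurable_indic; exact: measurable_itv.
    - by rewrite lee_fin divr_ge0// ?mulr_ge0// ltW.
    rewrite integral_indic//= setIidl; last first.
      by move=> x /=; rewrite !in_itv/= andbT => /andP[/(lt_le_trans r0)].
    rewrite lebesgue_measure_itv/= lte_fin ltr_pMl// ltr1n -EFinD -EFinM lee_fin.
    by rewrite le_eqVlt; apply/orP; left; apply/eqP; field; rewrite gt_eqF.
  apply: abse_integral_polar_le => //.
  - by apply: measurable_funM => //; exact: measurable_indic.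
  - move=> rho rho0; rewrite /shell_weight mulr_ge0//.
      by case/andP: (taub (rho ^+ 2 / r ^+ 2 - 1)).
    by rewrite divr_ge0 ?mulr_ge0 ?exprn_ge0// ltW.
  - by rewrite /shell_weight mulr0 mul0r mulr0.
  move=> rho rho0 s.
  have b0 : 0 <= b rho by rewrite /b mulr_ge0 ?indic_ge0// divr_ge0 ?mulr_ge0// ltW.
  have [/andP[r1 r2]|out] := boolP (r < rho < 2 * r).
    have [fs se] := HM _ (lt_trans rM r1).
    split; first by right.
    have sE : `|fine s| <= e by move: se; rewrite /= sub0r normrN.
    rewrite -(fineK (fs : s \is a fin_num)) abse_EFin -EFinM lee_fin.
    have -> : b rho = 8 / r * e.
      rewrite /b indicE mem_set/= ?in_itv/= ?(ltW r1) ?(ltW r2)// mulr1.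
      by rewrite mulrAC.
    have w0 : 0 <= 2 * rho / r ^+ 2.
      by rewrite divr_ge0 ?mulr_ge0 ?exprn_ge0// ltW.
    have /andP[t0 t2] := taub (rho ^+ 2 / r ^+ 2 - 1).
    apply: ler_pM => //; first exact: mulr_ge0.
    have -> : 8 / r = 2 * (2 * (2 * r) / r ^+ 2) by field; rewrite gt_eqF.
    by apply: ler_pM => //; rewrite ler_pM2r ?invr_gt0 ?exprn_gt0// ler_pM2l// ltW.
  (* A nonzero weight forces [r^2 < rho^2 < 2 r^2], hence [r < rho < 2 r]. Outside, the flux may be
     infinite, and the vanishing weight gives the left alternative. *)
  have w0 : shell_weight tau r rho = 0.
    rewrite /shell_weight tau0 ?mul0r//; apply: contra out => /andP[].
    rewrite subr_gt0 ltrBlDr ltr_pdivlMr ?exprn_gt0// ltr_pdivrMr ?exprn_gt0//.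
    rewrite mul1r ltr_sqr ?nnegrE ?(ltW r0) ?(ltW rho0)// => -> /= rho2.
    by rewrite -ltr_sqr ?nnegrE ?mulr_ge0 ?(ltW r0) ?(ltW rho0)//; nra.
  by rewrite w0 mul0e lee_fin; split; first by left.
(* Dominated convergence takes a sequence of radii; [m + 1] keeps them positive. The cutoff at [x]
   is 1 as soon as [enorm x <= m], and [|J k|] dominates. *)
pose Im (m : nat) := (\int[lebesgue_rV n]_x (cutoff psi m.+1%:R x * J k x)%:E)%E.
have cvgI : Im @ \oo --> (\int[lebesgue_rV n]_x (J k x)%:E)%E.
  have iJa := integrable_abse (IJ k).
  have [] := @dominated_convergence _ _ _ (lebesgue_rV n) setT measurableT
    (fun m x => (cutoff psi m.+1%:R x * J k x)%:E) (EFin \o J k) _ _ _ _ iJa _ => //.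
  - move=> m; apply/measurable_EFinP; apply: measurable_funM => //.
    exact: (measurable_cutoff _ dpsi).
  - exact/measurable_EFinP.
  - apply: aeW => x _; apply: cvg_near_cst; near=> m.
    rewrite /cutoff psi1 ?mul1r// subr_le0 ler_pdivrMr ?exprn_gt0// mul1r.
    rewrite ler_sqr ?nnegrE ?enorm_ge0//.
    apply: (@le_trans _ _ m%:R); last by rewrite ler_nat.
    by near: m; exact: nbhs_infty_ger.
  - apply: aeW => x m _; rewrite /= lee_fin normrM.
    by rewrite ler_piMl//; exact: psib.
apply/eqP; rewrite -abse_eq0 eq_le abse_ge0 andbT.
apply/lee_addgt0Pr => e e0; rewrite add0e.
have e8 : 0 < e / 8 by rewrite divr_gt0.
apply: (cvge_le _ (cvg_abse cvgI)).
have [M [_ HM]] := bound _ e8.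
near=> m.
have := HM m.+1%:R; rewrite mulrC divfK//; apply.
apply: (@lt_le_trans _ _ m%:R); last by rewrite ler_nat.
by near: m; exact: nbhs_infty_gtr.
Unshelve. all: by end_near. Qed.

End div_free.

Theorem mainTheorem1 (R : realType) (d m N : nat)
    (E : 'cV[R]_m * 'M[R]_(m, d) -> R) (T : 'I_N -> 'M[R]_m)
    (phi0 : 'rV[R]_d -> 'cV[R]_m)
    (E_smooth : smooth E)
    (E_invariant : invariant_density E T)
    (phi0_smooth : smooth phi0)
    (phi0_finite_energy : (lebesgue_rV d).-integrable setT
       (fun x : 'rV[R]_d => (E (jet phi0 x))%:E))
    (phi0_eom : static_eom E phi0)
    (J_integrable : forall (A : 'I_N) (i : 'I_d),
       (lebesgue_rV d).-integrable setT
         (fun x : 'rV[R]_d => (current E T phi0 A i x)%:E))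
    (boundary_terms : forall (A : 'I_N) (k : 'I_d),
       (\int[sphere_measure r]_(x in esphere r)
          (x ord0 k *
           \sum_(i < d) x ord0 i / enorm x * current E T phi0 A i x)%:E)%E
         @[r --> +oo%R] --> 0%E) :
  forall (A : 'I_N) (i : 'I_d),
    (\int[lebesgue_rV d]_x (current E T phi0 A i x)%:E)%E = 0%E.
Proof.
move=> A i; apply: (@integral_div_free_eq0 R d (current E T phi0 A) i).
- by move=> j; exact: Ck1_current.
- exact: J_integrable.
- by move=> x; exact: current_div_free.
- exact: boundary_terms.
Qed.
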